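(* Let $(G,T)$ be a bipartite graft, let $r\in V(G)$, and let $K$ be a decapital distance component of $(G,T)$ with respect to $r$. Let $\tilde S_K$ and $T_K$ be the root fragment and antiroot class of $K$. Then: (i) the set of connected components of $G[D(K)]$ is the disjoint union of the families $\mathcal{N}_K(S)$ over $S\in\mathcal{A}(K)$; accordingly, $D(K)$ is the disjoint union of the sets $N_K(S)$ over $S\in\mathcal{A}(K)$; (ii) for every minimum join $F$ of $(G,T)$: $N_K(\tilde S_K)=\mathrm{Neg}_F(\tilde S_K;T_K)$, and for every $S\in\mathcal{A}(K)\setminus\{\tilde S_K\}$, $N_K(S)=\mathrm{Neg}_F(S;T_K)=\mathrm{Neg}(S)$; accordingly, $D(K)$ equals the disjoint union of the sets $\mathrm{Neg}_F(S;T_K)$ over $S\in\mathcal{A}(K)$, which further equals the disjoint union of $\mathrm{Neg}_F(\tilde S_K;T_K)$ and the sets $\mathrm{Neg}(S)$ over $S\in\mathcal{A}(K)\setminus\{\tilde S_K\}$.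
   Context: All graphs are finite. For a graph $G$ and $X\subseteq V(G)$, $\partial_G(X)$ is the set of edges with exactly one end in $X$; for a subgraph $H$, $\partial_G(H):=\partial_G(V(H))$. A graft is a pair $(G,T)$ with $T\subseteq V(G)$ such that every connected component of $G$ contains an even number of vertices of $T$; bipartite if $G$ is. A join is a set $F\subseteq E(G)$ such that every vertex in $T$ is incident with an odd number of edges of $F$ and every other vertex with an even number; $\nu(G,T)$ is the minimum size of a join; minimum joins are joins of that size. For $F\subseteq E(G)$, $w_F(e)=-1$ if $e\in F$, $+1$ otherwise, extended additively to paths; for a minimum join $F$, $d_F(x,y)$ is the minimum $F$-weight of a path between $x$ and $y$ (independent of $F$). For a root $r$ and integer $i$, $L_{\le i}(r)=\{x:d_F(r,x)\le i\}$; the distance components with respect to $r$ are the connected components of $G[L_{\le i}(r)]$ for $i\in\{d_F(r,x):x\in V(G)\}$; those not containing $r$ are decapital. For a distance component $K$, $A(K)$ is the set of $x\in V(K)$ with $d_F(r,x)=\max_{y\in V(K)}d_F(r,y)$, and $D(K):=V(K)\setminus A(K)$. An edge is allowed if it lies in some minimum join. Two vertices are factor-connected if joined by a path of allowed edges; a factor-component is a maximal subgraph in which every two vertices are factor-connected. Write $u\sim v$ if $u=v$, or $u,v$ are distinct vertices of the same factor-component with $\nu(G,T)=\nu(G,T\Delta\{u,v\})$; $\sim$ is an equivalence relation with class family $\mathcal{P}(G,T)$. For a decapital distance component $K$, the ends inside $V(K)$ of the allowed edges in $\partial_G(K)$ all lie in one class $S_K$ (root class) and the ends outside $V(K)$ in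 one class $T_K$ (antiroot class); the root fragment is $\tilde S_K:=S_K\cap V(K)$, and $\mathcal{A}(K):=\{\tilde S_K\}\cup\{S\in\mathcal{P}(G,T)\setminus\{S_K\}: S\cap A(K)\ne\emptyset\}$. For $S$ with $S\cap A(K)\neq\emptyset$, $\mathcal{N}_K(S)$ is the family of connected components of $G[D(K)]$ containing a vertex joined by an allowed edge to a vertex of $S$, and $N_K(S)$ is the union of their vertex sets. For a minimum join $F$, $S\subseteq V(G)$ and $Y\subseteq V(G)\setminus S$, a set $X\subseteq V(G)\setminus S$ is $F$-negative for $S$ if for every $x\in X$ there is a path of negative $F$-weight between $x$ and a vertex of $S$ whose vertices other than that end lie in $X$; it avoids $Y$ if $X\cap Y=\emptyset$. $\mathrm{Neg}_F(S;Y)$ denotes the maximum $F$-negative set for $S$ avoiding $Y$, and $\mathrm{Neg}(S)$ the maximum $F$-negative set for $S$ (known to be independent of the minimum join $F$); maximum sets exist since unions of such sets are again such sets. *)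

(* Defs.v *)
From HB Require Import structures.
From mathcomp Require Import all_boot all_order all_algebra.
From mathcomp Require Import boolp.

Set Implicit Arguments.
Unset Strict Implicit.
Unset Printing Implicit Defensive.

Import Order.TTheory GRing.Theory Num.Theory.

(* Parallel edges are allowed. Loops are not: bipartite graphs have none. *)
Record multigraph := Multigraph {
  vertex : finType;
  edge : finType;
  ends : edge -> {set vertex};
  _ : forall e, #|ends e| = 2
}.

Arguments ends {m} _.

Definition disjoint_union (I U : finType) (P : {set I}) (f : I -> {set U})
    (X : {set U}) : Prop :=
  X = \bigcup_(i in P) f i /\
  {in P &, forall i j, i != j -> [disjoint f i & f j]}.

Definition symdiff (U : finType) (A B : {set U}) : {set U} :=
  (A :\: B) :|: (B :\: A).

Section Graph.

Variable G : multigraph.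
Local Notation V := (vertex G).
Local Notation E := (edge G).

Implicit Types (x y r u v : V) (e : E) (X Y S K C : {set V}) (F : {set E}).

Definition joins e x y : bool := ends e == [set x; y].

Definition adj x y : bool := [exists e, joins e x y].

Definition bipartite : Prop :=
  exists A : {set V}, forall e, #|ends e :&: A| = 1.

Definition boundary X : {set E} := [set e | #|ends e :&: X| == 1].

(* Vertex sets of the connected components of the induced subgraph on X. *)
Definition components X : {set {set V}} :=
  [set [set y | connect [rel a b | [&& a \in X, b \in X & adj a b]] x y]
    | x in X].

(* A walk starting at x is given by the list of its steps, each step being the
   edge followed and the vertex reached. *)
Fixpoint walk x (p : seq (E * V)) : bool :=
  if p is (e, y) :: p' then joins e x y && walk y p' else true.

Definition gpath x (p : seq (E * V)) y : bool :=
  [&& walk x p, uniq (x :: unzip2 p) & last x (unzip2 p) == y].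

Definition weight F (p : seq (E * V)) : int :=
  (\sum_(e <- unzip1 p) (if e \in F then -1 else 1))%R.

Definition is_dist F x y (d : int) : Prop :=
  (exists2 p, gpath x p y & weight F p = d) /\
  (forall p, gpath x p y -> (d <= weight F p)%R).

Definition level F r (i : int) : {set V} :=
  [set x | `[< exists2 d, is_dist F r x d & (d <= i)%R >]].

(* Components are represented by their vertex sets. *)
Definition distance_component F r K : Prop :=
  exists i : int, (exists x, is_dist F r x i) /\ K \in components (level F r i).

Definition decapital F r K : Prop := distance_component F r K /\ r \notin K.

Definition Apart F r K : {set V} :=
  [set x in K | `[< exists2 d, is_dist F r x d &
     forall y d', y \in K -> is_dist F r y d' -> (d' <= d)%R >]].

Definition Dpart F r K : {set V} := K :\: Apart F r K.

Definition negative_set F S X : Prop :=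
  [disjoint X & S] /\
  forall x, x \in X -> exists s p,
    [/\ s \in S, gpath s p x, (weight F p < 0)%R & {subset unzip2 p <= X}].

(* The union of all the F-negative sets for S avoiding Y; it is the largest
   such set, see NegAvoidP. *)
Definition NegAvoid F S Y : {set V} :=
  \bigcup_(X : {set V} | `[< negative_set F S X >] && [disjoint X & Y]) X.

Definition Neg F S : {set V} := NegAvoid F S set0.

Lemma NegAvoidP F S Y :
  [/\ negative_set F S (NegAvoid F S Y), [disjoint NegAvoid F S Y & Y] &
      forall X, negative_set F S X -> [disjoint X & Y] ->
        X \subset NegAvoid F S Y].
Proof.
have sub X : negative_set F S X -> [disjoint X & Y] -> X \subset NegAvoid F S Y.
  by move=> nX dX; apply: (bigcup_sup X) => //; apply/andP; split=> //; apply/asboolP.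
split=> //.
- split.
    rewrite disjoint_subset; apply/subsetP => x /bigcupP[X /andP[/asboolP[dX _] _] xX].
    by move: dX; rewrite disjoint_subset => /subsetP /(_ _ xX).
  move=> x /bigcupP[X /andP[/asboolP nX dX] xX].
  have [s [p [sS gp wp pX]]] := nX.2 x xX.
  by exists s, p; split=> // y /pX; apply/subsetP/sub.
- rewrite disjoint_subset; apply/subsetP => x /bigcupP[X /andP[_ dX] xX].
  by move: dX; rewrite disjoint_subset => /subsetP /(_ _ xX).
Qed.

Definition graft (T : {set V}) : Prop :=
  forall C, C \in components [set: V] -> ~~ odd #|C :&: T|.

Definition is_join (T : {set V}) F : bool :=
  [forall v, odd #|[set e in F | v \in ends e]| == (v \in T)].

Definition min_join (T : {set V}) F : bool :=
  is_join T F && [forall F' : {set E}, is_join T F' ==> (#|F| <= #|F'|)].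

(* The default value setT only matters when there is no join at all. *)
Definition nu (T : {set V}) : nat :=
  #|[arg min_(F < [set: E] | is_join T F) #|F|]|.

Section Classes.

Variable T : {set V}.

Definition allowed e : bool := [exists F : {set E}, min_join T F && (e \in F)].

Definition allowed_adj x y : bool := [exists e, allowed e && joins e x y].

Definition factor_connected u v : bool := connect allowed_adj u v.

Definition factor_component C : bool :=
  maxset (fun C' : {set V} =>
    [forall u in C', forall v in C', factor_connected u v]) C.

Definition equiv_vertices u v : bool :=
  (u == v) ||
  [exists C, [&& factor_component C, u \in C & v \in C]] &&
  (nu T == nu (symdiff T [set u; v])).

Definition vertex_classes : {set {set V}} :=
  [set [set v | equiv_vertices u v] | u : V].

Definition inner_ends K : {set V} :=
  \bigcup_(e in boundary K | allowed e) (ends e :&: K).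

Definition outer_ends K : {set V} :=
  \bigcup_(e in boundary K | allowed e) (ends e :\: K).

(* For a decapital distance component K there are allowed edges in the boundary
   and there is exactly one class to pick in the next two definitions. *)
Definition root_class K : {set V} :=
  odflt set0 [pick S in vertex_classes | inner_ends K \subset S].

Definition antiroot_class K : {set V} :=
  odflt set0 [pick S in vertex_classes | outer_ends K \subset S].

Definition root_fragment K : {set V} := root_class K :&: K.

Definition Aclasses F r K : {set {set V}} :=
  root_fragment K |:
  [set S in vertex_classes :\ root_class K | S :&: Apart F r K != set0].

Definition Ncomps F r K S : {set {set V}} :=
  [set C in components (Dpart F r K) |
    [exists x in C, exists s in S, allowed_adj x s]].

Definition Nset F r K S : {set V} := \bigcup_(C in Ncomps F r K S) C.

End Classes.

End Graph.

(* Main.v *)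
(** Write [nu U] for the minimum size of a [U]-join and [f x := nu (T + r + x)],
    where [+] is the symmetric difference; then [d_F(r, x) = f x - nu T], and
    in a bipartite graph [f] changes by exactly one along every edge.

    Everything rests on one inequality: if [u] and [s] are connected inside
    [{f <= f u}], then [f z + f s <= nu (T + r + z + u + s) + f u] for all [z].
    It is proved by moving [s] along a path, with the exchange property of joins
    (the symmetric difference of two joins contains a path between two vertices
    of the symmetric difference of their odd sets, along which both joins can be
    switched). For a distance component [K] it yields Sebő's theorem: minimum
    joins have no edge in the boundary of [K] if [r] is in [K], and exactly one
    otherwise. It also yields that equivalent vertices have the same distance to
    every vertex, whence the classes, and that top vertices of [K] are at
    nonnegative distance from each other.

    Each component [C] of [G[D(K)]] is itself a decapital distance component, so
    its allowed boundary edges lead to a single class; this is (i). For (ii), a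
    negative set for [S] cannot meet [A(K)]. It cannot reach outside [K] either:
    measured from the inner end of the edge of [F] leaving [K], its vertices next
    to [S] would be top vertices of a component of level -1, joined by a path of
    negative weight. Hence it lies in [D(K)], and the same argument inside a
    component [C] shows that the edge of [F] leaving [C] ends in [S]. *)
Require Import Defs.
From mathcomp Require Import all_boot all_order all_algebra.
From mathcomp Require Import boolp zify.

Set Implicit Arguments.
Unset Strict Implicit.
Unset Printing Implicit Defensive.

Import Order.TTheory GRing.Theory Num.Theory.

(** * Symmetric differences of finite sets *)

Local Notation "A :+: B" := (symdiff A B) (at level 50, left associativity).
Local Notation "A ~+ x" := (symdiff A [set x]) (at level 50, left associativity).

Lemma in_symdiff (U : finType) (A B : {set U}) x :
  (x \in A :+: B) = (x \in A) (+) (x \in B).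
Proof. by rewrite /symdiff !inE; case: (x \in A); case: (x \in B). Qed.

Ltac xor_eq :=
  let v := fresh "v" in
  apply/setP => v; rewrite !(in_symdiff, in_set1);
  repeat match goal with
  | |- context [v \in ?A] => generalize (v \in A)
  | |- context [v == ?x] => generalize (v == x)
  end; clear; by do ?case.

Section SymDiff.
Variable U : finType.
Implicit Types A B P : {set U}.

Lemma symdiffK A B : A :+: B :+: B = A.
Proof. by xor_eq. Qed.

Lemma card_symdiff A B : #|A :+: B| + 2 * #|A :&: B| = #|A| + #|B|.
Proof.
rewrite /symdiff cardsU.
have -> : (A :\: B) :&: (B :\: A) = set0.
  by apply/setP => x; rewrite !inE; case: (x \in A); case: (x \in B).
rewrite cards0 subn0 -(cardsID B A) -(cardsID A B) (setIC B A); lia.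
Qed.

Lemma odd_card_symdiff A B : odd #|A :+: B| = odd #|A| (+) odd #|B|.
Proof. by rewrite -oddD -card_symdiff oddD mul2n odd_double addbF. Qed.

Lemma card_symdiff_le A x : #|A ~+ x| <= #|A|.+1.
Proof. by have := card_symdiff A [set x]; rewrite cards1; lia. Qed.

Lemma card_symdiff_in A x : x \in A -> (#|A ~+ x|).+1 = #|A|.
Proof.
move=> xA; have := card_symdiff A [set x].
by rewrite (setIidPr _) ?sub1set // cards1; lia.
Qed.

(** Every element of [P] lies in exactly one of [A] and [B], so toggling [P] moves it from one to
    the other. *)
Lemma card_symdiff_exchange A B P :
  P \subset A :+: B -> #|A :+: P| + #|B :+: P| = #|A| + #|B|.
Proof.
move=> /subsetP sP.
have := card_symdiff A P; have := card_symdiff B P.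
have : #|A :&: P| + #|B :&: P| = #|P|.
  rewrite -(cardsID A P) (setIC A); congr (_ + _); apply: eq_card => x.
  rewrite !inE; case xP: (x \in P); rewrite ?andbF //.
  by move: (sP _ xP); rewrite in_symdiff; case: (x \in A); case: (x \in B).
lia.
Qed.

End SymDiff.

(** * Degrees, joins and the minimum size of a join *)

Lemma card_ends (G : multigraph) (e : edge G) : #|ends e| = 2.
Proof. by case: G e. Qed.

Section Joins.
Variable G : multigraph.
Local Notation V := (vertex G).
Local Notation E := (edge G).
Implicit Types (x y z r s u v a b : V) (e : E) (X K C U W Q T A B : {set V}).
Implicit Types (F J D : {set E}) (p : seq (E * V)).

Definition degree F v := #|[set e in F | v \in ends e]|.

Definition feasible U : bool := [exists F : {set E}, is_join U F].

Lemma joins_neq e x y : joins e x y -> x != y.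
Proof.
move=> /eqP exy; apply/eqP => xy.
have := card_ends e.
by rewrite exy xy setUid cards1.
Qed.

Lemma joins_sym e x y : joins e x y = joins e y x.
Proof. by rewrite /joins setUC. Qed.

Lemma joins_ends e x y v : joins e x y -> (v \in ends e) = (v == x) (+) (v == y).
Proof.
move=> exy; have := joins_neq exy; move/eqP: exy => ->; rewrite !inE.
by case: (v =P x) => [->|_]; case: (_ =P y) => // -> /eqP.
Qed.

Lemma joins_exists e : exists x y, joins e x y.
Proof.
have /eqP/cards2P [x [y [_ exy]]] := card_ends e.
by exists x, y; apply/eqP.
Qed.

Lemma joinP U F : reflect (forall v, odd (degree F v) = (v \in U)) (is_join U F).
Proof. by apply: (iffP forallP) => h v; apply/eqP; apply: h. Qed.

Lemma odd_degree_symdiff F F' v :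
  odd (degree (F :+: F') v) = odd (degree F v) (+) odd (degree F' v).
Proof.
rewrite /degree -odd_card_symdiff; congr odd; apply: eq_card => e.
by rewrite !(inE, in_symdiff); case: (e \in F); case: (e \in F'); case: (v \in _).
Qed.

Lemma join_symdiff U W F D :
  is_join U F -> is_join W D -> is_join (U :+: W) (F :+: D).
Proof.
move=> /joinP hF /joinP hD; apply/joinP => v.
by rewrite odd_degree_symdiff in_symdiff hF hD.
Qed.

Lemma join_eq U W F : is_join U F -> U = W -> is_join W F.
Proof. by move=> h <-. Qed.

Lemma odd_degree1 e v : odd (degree [set e] v) = (v \in ends e).
Proof.
rewrite /degree; case ve: (v \in ends e).
  rewrite (_ : [set _ in _ | _] = [set e]) ?cards1 //.
  by apply/setP => e'; rewrite !inE; case: (e' =P e) => // ->; rewrite ve.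
rewrite (_ : [set _ in _ | _] = set0) ?cards0 //.
by apply/setP => e'; rewrite !inE; case: (e' =P e) => // ->; rewrite ve.
Qed.

Lemma join1 e x y : joins e x y -> is_join ([set x] ~+ y) [set e].
Proof.
move=> exy; apply/joinP => v.
by rewrite odd_degree1 in_symdiff !inE (joins_ends v exy).
Qed.

Lemma join_edge U F e x y : joins e x y -> is_join U F -> is_join (U ~+ x ~+ y) (F ~+ e).
Proof. by move=> exy hF; apply: join_eq (join_symdiff hF (join1 exy)) _; xor_eq. Qed.

Lemma feasible_join U F : is_join U F -> feasible U.
Proof. by move=> h; apply/existsP; exists F. Qed.

Lemma nu_arg U : feasible U -> exists F, [/\ is_join U F, #|F| = nu U &
  forall F', is_join U F' -> #|F| <= #|F'|].
Proof.
move=> /existsP[F0 h0]; rewrite /nu /arg_min /extremum.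
case: pickP => [F /andP[hF /forallP hmin] | none] /=.
  by exists F; split=> // F' hF'; have := hmin F'; rewrite hF'.
case: (arg_minnP (fun F : {set E} => #|F|) h0) => F hF hmin.
have := none F; rewrite /= hF /= => /negbT /forallPn[F'].
by rewrite negb_imply => /andP[/hmin ->].
Qed.

Lemma nu_le U F : is_join U F -> nu U <= #|F|.
Proof. by move=> h; have [F' [_ <- ->]] := nu_arg (feasible_join h). Qed.

Lemma nu_join U : feasible U -> exists2 F, is_join U F & #|F| = nu U.
Proof. by case/nu_arg => F [? ? _]; exists F. Qed.

Lemma min_joinP U F : reflect (is_join U F /\ #|F| = nu U) (min_join U F).
Proof.
apply: (iffP andP) => -[hF h]; split=> //.
  have [F' [hF' <- hmin]] := nu_arg (feasible_join hF).
  by apply/eqP; rewrite eqn_leq hmin // andbT; move/forallP/(_ F'): h; rewrite hF'.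
by apply/forallP => F'; apply/implyP => /nu_le; rewrite h.
Qed.

Lemma feasible_edge U e x y : joins e x y -> feasible U -> feasible (U ~+ x ~+ y).
Proof.
by move=> exy /existsP[F hF]; apply: feasible_join (join_edge exy hF).
Qed.

Lemma handshake D X :
  \sum_(v in X) degree D v = \sum_(e in D) #|ends e :&: X|.
Proof.
transitivity (\sum_(v in X) \sum_(e in D) (v \in ends e : nat)).
  apply: eq_bigr => v _; rewrite /degree -sum1_card big_mkcond [RHS]big_mkcond.
  by apply: eq_bigr => e _; rewrite !inE; case: (e \in D); case: (v \in _).
rewrite exchange_big; apply: eq_bigr => e _.
rewrite -sum1_card big_mkcond [RHS]big_mkcond.
by apply: eq_bigr => v _; rewrite !inE; case: (v \in X); case: (v \in ends e).
Qed.

(** Each edge has exactly one end in the colour class [A], so [#|D|] is a sum over [A] of degrees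
    that are all even. *)
Lemma even_join_card D : bipartite G -> is_join set0 D -> ~~ odd #|D|.
Proof.
move=> [A hA] /joinP hD.
have <- : \sum_(v in A) degree D v = #|D|.
  by rewrite handshake -sum1_card; apply: eq_bigr => e _; apply: hA.
rewrite -dvdn2; apply: dvdn_sum => v _.
by rewrite dvdn2 hD inE.
Qed.

(** Toggling [e] shows that the two minima differ by at most one. Their parities differ, since
    [F :+: (F' ~+ e)] has even degrees everywhere and therefore an even number of edges. *)
Lemma nu_adj U e x y : bipartite G -> joins e x y -> feasible U ->
  nu (U ~+ x ~+ y) = (nu U).+1 \/ nu U = (nu (U ~+ x ~+ y)).+1.
Proof.
move=> bip exy fU; have fU' := feasible_edge exy fU.
have [F hF cF] := nu_join fU; have [F' hF' cF'] := nu_join fU'.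
have l1 : nu (U ~+ x ~+ y) <= (nu U).+1.
  by rewrite -cF; apply: leq_trans (nu_le (join_edge exy hF)) (card_symdiff_le _ _).
have l2 : nu U <= (nu (U ~+ x ~+ y)).+1.
  rewrite -cF'; apply: leq_trans (card_symdiff_le _ e); apply: nu_le.
  by apply: join_eq (join_edge exy hF') _; xor_eq.
have : ~~ odd #|F :+: (F' ~+ e)|.
  apply: even_join_card bip _.
  by apply: join_eq (join_symdiff hF (join_edge exy hF')) _; rewrite -setP => v;
    rewrite !in_symdiff !inE; case: (v \in U); case: (v == x); case: (v == y).
by rewrite !odd_card_symdiff cards1 cF cF'; move: l1 l2; clear; lia.
Qed.

(** * Paths as joins, and weight as change of size *)

Definition path_edges p : {set E} := [set e in unzip1 p].

Lemma walk_ends x p e : walk x p -> e \in unzip1 p ->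
  forall v, v \in ends e -> v \in x :: unzip2 p.
Proof.
elim: p x => [|[e' y] p IH] x //= /andP[exy wp]; rewrite inE => /predU1P[->|ep] v.
  by rewrite (joins_ends v exy) !inE; case: (v == x); case: (v == y).
by move=> /(IH _ wp ep); rewrite !inE => ->; rewrite orbT.
Qed.

Lemma gpath_cons e y p x z : gpath x ((e, y) :: p) z =
  [&& joins e x y, x \notin y :: unzip2 p & gpath y p z].
Proof. by rewrite /gpath /= -!andbA; do !bool_congr. Qed.

Lemma gpath_uniq_edges x p y : gpath x p y -> uniq (unzip1 p).
Proof.
elim: p x => [|[e z] p IH] x //; rewrite gpath_cons => /and3P[exz xp gp] /=.
rewrite (IH _ gp) andbT; apply/negP => ep; case/and3P: gp => wp _ _.
by case/negP: xp; apply: walk_ends wp ep _ _; rewrite (joins_ends x exz) eqxx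
  (negbTE (joins_neq exz)).
Qed.

Lemma gpath_join x p y : gpath x p y -> is_join ([set x] ~+ y) (path_edges p).
Proof.
elim: p x => [|[e z] p IH] x gp.
  move: gp; rewrite /gpath /= => /eqP <-; apply/joinP => v.
  rewrite in_symdiff addbb /degree (_ : [set _ in _ | _] = set0) ?cards0 //.
  by apply/setP => e; rewrite !inE.
have := gpath_uniq_edges gp.
move: gp; rewrite gpath_cons => /and3P[exz _ gp] /= /andP[ep _].
have -> : path_edges ((e, z) :: p) = path_edges p ~+ e.
  apply/setP => e'; rewrite in_symdiff !inE.
  by case: (e' =P e) => [->|_]; rewrite ?(negbTE ep) ?addbF.
by apply: join_eq (join_edge exz (IH _ gp)) _; xor_eq.
Qed.

Lemma weight_cons F e y p :
  weight F ((e, y) :: p) = ((if e \in F then -1 else 1) + weight F p)%R.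
Proof. by rewrite /weight /= big_cons. Qed.

Lemma eq_weight F F' p : {in unzip1 p, F =i F'} -> weight F p = weight F' p.
Proof.
by move=> h; rewrite /weight; apply: eq_big_seq => e /h ->.
Qed.

(** A path uses each of its edges once, so its weight is the change in size when [F] is switched
    along it. This turns statements on weights into statements on sizes of joins. *)
Lemma card_path F x p y : gpath x p y ->
  ((#|F :+: path_edges p|)%:Z = (#|F|)%:Z + weight F p)%R.
Proof.
elim: p x F => [|[e z] p IH] x F gp.
  rewrite /weight big_nil addr0; congr Posz; apply: eq_card => e.
  by rewrite in_symdiff !inE addbF.
have := gpath_uniq_edges gp.
move: gp; rewrite gpath_cons => /and3P[exz _ gp] /= /andP[ep _].
have -> : F :+: path_edges ((e, z) :: p) = F ~+ e :+: path_edges p.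
  apply/setP => e'; rewrite !(in_symdiff, inE).
  by case: (e' =P e) => [->|_]; rewrite ?(negbTE ep) ?addbF.
rewrite (IH _ _ gp) weight_cons.
rewrite (@eq_weight _ F); last first.
  move=> e' e'p; rewrite in_symdiff inE; case: eqP => [e'e|]; last by rewrite addbF.
  by rewrite e'e (negbTE ep) in e'p.
rewrite addrA; congr (_ + _)%R.
have := card_symdiff F [set e]; rewrite cards1; case: ifP => eF.
  by have := card_symdiff_in eF; lia.
rewrite (_ : F :&: [set e] = set0) ?cards0; first by lia.
by apply/setP => e'; rewrite !inE; case: (e' =P e) => [->|]; rewrite ?eF ?andbF.
Qed.

Lemma join_path F U x p y : is_join U F -> gpath x p y ->
  is_join (U ~+ x ~+ y) (F :+: path_edges p).
Proof. by move=> hF /gpath_join hp; apply: join_eq (join_symdiff hF hp) _; xor_eq. Qed.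

(** * The exchange property of joins *)

(** If [B] were out of reach, the vertices reached from [v] along [D] would be closed under [D] with
    [v] as their only vertex of odd degree, against the handshake count. *)
Lemma path_to_set D v B : v \notin B -> odd (degree D v) ->
  (forall u, u \notin B -> u != v -> ~~ odd (degree D u)) ->
  exists p x, [/\ gpath v p x, x \in B, {subset unzip1 p <= D} &
    {in belast v (unzip2 p), forall u, u \notin B}].
Proof.
move=> vB dv dB.
(* Steps leave only vertices outside [B], so a path of [R] can meet [B] in its last vertex alone. *)
pose R := [rel a b | (a \notin B) && [exists e in D, joins e a b]].
case: (pickP [pred x | (x \in B) && connect R v x]) => [x /andP[xB] | none].
  move=> /connectP[q pq xq]; move: xB; rewrite {}xq.
  case: (shortenP pq) => q' pq' uq' _ xB.
  suff [p [wp pq2 pD pB]] : exists p, [/\ walk v p, unzip2 p = q',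
      {subset unzip1 p <= D} & {in belast v (unzip2 p), forall u, u \notin B}].
    by exists p, (last v q'); split=> //; rewrite /gpath wp pq2 uq' eqxx.
  elim: q' v {vB dv dB q uq' xB pq} pq' => [|y q IH] v /=.
    by exists [::]; split.
  case/andP=> /andP[vB /exists_inP[e eD evy]] /IH [p [wp <- pD pB]].
  exists ((e, y) :: p); split=> //=; first by rewrite evy.
    by move=> e'; rewrite inE => /predU1P[->|/pD].
  by move=> u; rewrite inE => /predU1P[->|/pB].
pose C := [set x | connect R v x].
have CB x : x \in C -> x \notin B.
  by rewrite inE => vx; have := none x; rewrite /= vx andbT => ->.
have vC : v \in C by rewrite inE.
have even : ~~ odd (\sum_(x in C) degree D x).
  rewrite handshake -dvdn2; apply: dvdn_sum => e eD.
  have [x [y exy]] := joins_exists e.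
  have cl x' y' : joins e x' y' -> x' \in C -> y' \in C.
    move=> exy' xC; rewrite inE; move: (xC); rewrite inE => /connect_trans; apply.
    by apply: connect1; rewrite /= (CB _ xC); apply/exists_inP; exists e.
  case xC: (x \in C).
    rewrite (setIidPl _) ?card_ends //.
    apply/subsetP => z; rewrite (joins_ends z exy).
    by case: (z =P x) => [->|_] //=; case: (z =P y) => // -> _; apply: cl exy xC.
  rewrite (_ : _ :&: _ = set0) ?cards0 //; apply/setP => z.
  rewrite !inE (joins_ends z exy).
  case: (z =P x) => [->|_] /=; first by move: xC; rewrite inE => ->; rewrite andbF.
  case: (z =P y) => // -> /=; apply/negP => vy.
  by move/negP: xC; apply; apply: (cl y); rewrite ?inE // joins_sym.
case/negP: even; rewrite (bigD1 v) //= oddD dv /= -dvdn2.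
by apply: dvdn_sum => u /andP[uC uv]; rewrite dvdn2 dB ?CB.
Qed.

(** The odd-degree vertices of [J :+: J'] are those of [A :+: B], so a path inside it leads from [v]
    to another of them. Switching both joins along this path keeps the total size. *)
Lemma join_exchange A B J J' v : is_join A J -> is_join B J' -> v \in A :+: B ->
  exists v', [/\ v' \in A :+: B, v' != v & exists J1 J2,
    [/\ is_join (A ~+ v ~+ v') J1, is_join (B ~+ v ~+ v') J2 &
        #|J1| + #|J2| = #|J| + #|J'|]].
Proof.
move=> hJ hJ' vAB; have /joinP hD := join_symdiff hJ hJ'.
have [||u|p [v' [gp]]] := @path_to_set (J :+: J') v ((A :+: B) :\ v).
- by rewrite !inE eqxx.
- by rewrite hD.
- by rewrite hD !inE; case: (u == v).
rewrite in_setD1 => /andP[v'v v'AB] pD _.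
exists v'; split=> //; exists (J :+: path_edges p), (J' :+: path_edges p).
split; try exact: join_path.
by apply: card_symdiff_exchange; apply/subsetP => e; rewrite inE => /pD.
Qed.

(** [D] contains a path from [x] to [y]. Switching [F :+: D] along it gives a [T]-join again, hence
    at least [#|F|] edges; the exchange identity then bounds [F] switched along it by
    [#|F :+: D|]. *)
Lemma path_of_join T F D x y : min_join T F -> is_join ([set x] ~+ y) D ->
  exists p, [/\ gpath x p y, {subset unzip1 p <= D} &
    ((#|F|)%:Z + weight F p <= (#|F :+: D|)%:Z)%R].
Proof.
move=> /min_joinP[hF cF] hD.
have [p [gp pD]] : exists p, gpath x p y /\ {subset unzip1 p <= D}.
  have [<-|xy] := eqVneq x y; first by exists [::]; rewrite /gpath /= eqxx.
  have /joinP dD := hD.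
  have [||u|p [v' [gp]]] := @path_to_set D x [set y].
  - by rewrite inE.
  - by rewrite dD in_symdiff !inE eqxx (negbTE xy).
  - by rewrite dD in_symdiff !inE; case: (u == y) => //; case: (u == x).
  by rewrite inE => /eqP yv pD _; exists p; split=> //; rewrite -yv.
exists p; split=> //; rewrite -(card_path F gp).
have sP : path_edges p \subset F :+: (F :+: D).
  by apply/subsetP => e; rewrite !in_symdiff inE => /pD ->; case: (e \in F).
have := card_symdiff_exchange sP.
have : nu T <= #|F :+: D :+: path_edges p|.
  apply: nu_le; apply: join_eq (join_path (join_symdiff hF hD) gp) _; xor_eq.
rewrite -cF; lia.
Qed.

(** * The potential and the three-vertex inequality *)

(** For [Q = T ~+ r] this is the distance from [r] shifted by [nu T]. [Q] stays general because
    distances are also measured from other vertices. *)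
Definition potential Q x := nu (Q ~+ x).

Lemma potential_adj Q e x y : bipartite G -> joins e x y -> feasible (Q ~+ x) ->
  feasible (Q ~+ y) /\ (potential Q y = (potential Q x).+1 \/
                        potential Q x = (potential Q y).+1).
Proof.
move=> bip exy fx; have E1 : Q ~+ x ~+ x ~+ y = Q ~+ y by xor_eq.
have := nu_adj bip exy fx; have := feasible_edge exy fx.
by rewrite E1 /potential => -> []; auto.
Qed.

(* The inequality propagates along an edge [y - s] of the level set: when the potential drops
   from [y] to [s], toggle the edge; when it rises, exchange at [y] against a
   minimum join for [y], the three outcomes being all large enough. *)
Lemma potential_triple Q u s z J : bipartite G -> feasible (Q ~+ u) ->
  connect [rel a b | [&& potential Q a <= potential Q u,
                         potential Q b <= potential Q u & adj a b]] u s ->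
  is_join (Q ~+ z ~+ u ~+ s) J ->
  potential Q z + potential Q s <= #|J| + potential Q u.
Proof.
move=> bip fu /connectP[q].
pose P y := forall z J, is_join (Q ~+ z ~+ u ~+ y) J ->
  potential Q z + potential Q y <= #|J| + potential Q u.
suff main y : feasible (Q ~+ y) -> P y -> path [rel a b |
    [&& potential Q a <= potential Q u, potential Q b <= potential Q u & adj a b]] y q ->
    s = last y q -> P s.
  move=> pq sq; apply: (main u fu) => // z' J' hJ'.
  by rewrite leq_add2r; apply: nu_le; apply: join_eq hJ' _; xor_eq.
elim: q y => [|x q IH] y fy Py /=; first by move=> _ ->.
case/andP=> /and3P[yu xu /existsP[e eyx]] pq sq.
have [fx fyx] := potential_adj bip eyx fy.
apply: (IH x fx _ pq sq) => z' J' hJ' {IH pq sq}.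
have hJe := join_edge eyx hJ'; have cJe := card_symdiff_le J' e.
case: fyx => fyx; last first.
  have /Py : is_join (Q ~+ z' ~+ u ~+ y) (J' ~+ e) by apply: join_eq hJe _; xor_eq.
  by move: fyx cJe; clear; lia.
(* If [z' = y], the vertex [y] is not in the symmetric difference of the two odd sets and cannot be
   exchanged; toggling [e] already gives a join for [Q ~+ u]. *)
have [z'y|z'y] := eqVneq z' y.
  have /nu_le : is_join (Q ~+ u) (J' ~+ e) by apply: join_eq hJe _; rewrite z'y; xor_eq.
  by rewrite -/(potential Q u) z'y; move: fyx xu cJe; clear; lia.
have yx : y != x by apply: joins_neq eyx.
have uy : u != y by apply/eqP => uy; move: xu; rewrite fyx uy ltnn.
have [Fy hFy cFy] := nu_join fy.
have [|v' [v'in v'y [J1 [J2 [h1 h2 c12]]]]] := join_exchange hJ' hFy (v := y).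
  by rewrite !in_symdiff !inE eqxx ![y == _]eq_sym (negbTE z'y) (negbTE uy)
    [x == y]eq_sym (negbTE yx); case: (y \in Q).
rewrite -/(potential Q y) in cFy.
have : v' \in [:: z'; u; x].
  move: v'in; rewrite !in_symdiff !inE (negbTE v'y).
  by case: (v' == z'); case: (v' == u); case: (v' == x); case: (v' \in Q).
rewrite !inE => /or3P[] /eqP v'E; rewrite {}v'E {v'in v'y} in h1 h2.
- have /nu_le : is_join (Q ~+ z') J2 by apply: join_eq h2 _; xor_eq.
  have /nu_le : is_join (Q ~+ u) (J1 ~+ e) by apply: join_eq (join_edge eyx h1) _; xor_eq.
  have := card_symdiff_le J1 e; rewrite -!/(potential Q _).
  by move: c12 cFy fyx xu; clear; lia.
- have /nu_le : is_join (Q ~+ u) J2 by apply: join_eq h2 _; xor_eq.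
  have /nu_le : is_join (Q ~+ z') (J1 ~+ e) by apply: join_eq (join_edge eyx h1) _; xor_eq.
  have := card_symdiff_le J1 e; rewrite -!/(potential Q _).
  by move: c12 cFy fyx xu; clear; lia.
- have /nu_le : is_join (Q ~+ x) J2 by apply: join_eq h2 _; xor_eq.
  have /Py : is_join (Q ~+ z' ~+ u ~+ y) J1 by apply: join_eq h1 _; xor_eq.
  by rewrite -!/(potential Q _); move: c12 cFy; clear; lia.
Qed.

(** * Level components and their boundary edges *)

Lemma boundaryP K e : reflect (exists x y, [/\ joins e x y, x \in K & y \notin K])
  (e \in boundary K).
Proof.
have cE x' y' : joins e x' y' -> #|ends e :&: K| = (x' \in K) + (y' \in K).
  move=> exy'; have := joins_neq exy'; move/eqP: exy' => -> xy.
  rewrite setIUl cardsU (_ : [set x'] :&: K :&: ([set y'] :&: K) = set0)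
    ?cards0 ?subn0; last first.
    apply/setP => v; rewrite !inE; case: (v =P x') => // ->.
    by rewrite (negbTE xy) andbF.
  have c1 w : #|[set w] :&: K| = (w \in K).
    case wK: (w \in K); first by rewrite (setIidPl _) ?sub1set // cards1.
    apply/eqP; rewrite cards_eq0; apply/eqP/setP => v; rewrite !inE.
    by case: (v =P w) => // ->.
  by rewrite !c1.
rewrite inE; apply: (iffP eqP) => [|[x' [y' [exy' xK yK]]]].
  have [x [y exy]] := joins_exists e.
  rewrite (cE x y exy); case xK: (x \in K); case yK: (y \in K) => // _.
    by exists x, y; rewrite xK yK.
  by exists y, x; rewrite xK yK joins_sym.
by rewrite (cE _ _ exy') xK (negbTE yK).
Qed.

Definition connected_in X : Prop := {in X &, forall x y,
  connect [rel a b | [&& a \in X, b \in X & adj a b]] x y}.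

(** The last clause is the maximality of a component of the level set at [m]. Feasibility is
    recorded because [nu] takes a default value where there is no join. *)
Definition level_component Q m K : Prop :=
  [/\ {in K, forall x, feasible (Q ~+ x) /\ potential Q x <= m}, connected_in K &
      forall e x y, joins e x y -> x \in K -> y \notin K -> m < potential Q y].

Section Level.
Variables (Q K : {set V}) (m : nat).
Hypothesis bip : bipartite G.
Hypothesis lvlK : level_component Q m K.
Local Notation f := (potential Q).

Lemma level_boundary e x y : joins e x y -> x \in K -> y \notin K ->
  [/\ f x = m, f y = m.+1 & feasible (Q ~+ y)].
Proof.
case: lvlK => fK _ up exy xK yK; have [fx lx] := fK _ xK.
have my := up _ _ _ exy xK yK.
by have [fy [] h] := potential_adj bip exy fx; split=> //; move: h lx my; clear; lia.
Qed.

Lemma level_triple u s z J : u \in K -> s \in K -> f u = m ->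
  is_join (Q ~+ z ~+ u ~+ s) J -> f z + f s <= #|J| + f u.
Proof.
case: lvlK => fK cK _ uK sK um; apply: potential_triple => //.
  by have [] := fK _ uK.
apply: connect_sub (cK _ _ uK sK) => a b /and3P[aK bK ab]; apply: connect1.
by rewrite /= um ab andbT; have [_ ->] := fK _ aK; have [_ ->] := fK _ bK.
Qed.

(** Deleting a boundary edge from [x] in [K] to [y] outside would leave a join for
    [Q ~+ y ~+ x ~+ z] with [f z - 1] edges. As [f y = f x + 1], the inequality requires at least
    [f z + 1]. *)
Lemma level_inside z F : z \in K -> min_join (Q ~+ z) F ->
  {in F, forall e, e \notin boundary K}.
Proof.
move=> zK /min_joinP[hF cF] e eF; apply/boundaryP => -[x [y [exy xK yK]]].
have [fx fy _] := level_boundary exy xK yK.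
have h : is_join (Q ~+ y ~+ x ~+ z) (F ~+ e).
  by apply: join_eq (join_edge exy hF) _; xor_eq.
have := level_triple xK zK fx h; have := card_symdiff_in eF.
rewrite -/(f z) in cF; move: cF fy fx; clear; lia.
Qed.

(** [F] is compared with a minimum join [Fk] for [Q ~+ k] along a path of [F :+: Fk] from [z] to its
    first vertex [v] in [K]. The path crosses the boundary only by its last edge, and switching it
    turns [F] into a minimum join for [Q ~+ v], which has no boundary edge by [level_inside]. *)
Lemma level_outside k z F : k \in K -> z \notin K -> min_join (Q ~+ z) F ->
  exists e x y, [/\ joins e x y, x \in K, y \notin K, e \in F &
    forall e', e' \in F -> e' \in boundary K -> e' = e].
Proof.
move=> kK zK /min_joinP[hF cF].
have [fk _] : feasible (Q ~+ k) /\ f k <= m by case: lvlK => fK _ _; apply: fK.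
have [Fk hFk cFk] := nu_join fk.
have /joinP hD := join_symdiff hF hFk.
have [|u uK uz|p [v [gp vK pD pK]]] := @path_to_set (F :+: Fk) z K zK.
- rewrite hD !in_symdiff !inE eqxx.
  have -> : (z == k) = false by apply/eqP => zk; rewrite zk kK in zK.
  by case: (z \in Q).
- rewrite hD !in_symdiff !inE (negbTE uz).
  have -> : (u == k) = false by apply/eqP => uk; rewrite uk kK in uK.
  by case: (u \in Q).
case/lastP: p gp pD pK => [|p [e w]] gp pD pK.
  by move: gp; rewrite /gpath /= => /eqP zv; rewrite zv vK in zK.
have wv : w = v.
  by case/and3P: gp => _ _ /eqP <-; rewrite /unzip2 map_rcons last_rcons.
rewrite {}wv in gp pD pK.
have pK' u : u \in z :: unzip2 p -> u \notin K.
  by move=> up; apply: pK; rewrite /unzip2 map_rcons belast_rcons.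
have walk_rcons x q c : walk x (rcons q c) ->
    walk x q /\ joins c.1 (last x (unzip2 q)) c.2.
  elim: q x => [|[e1 w1] q IH] x /=; first by case: c => ? ? /=; rewrite andbT.
  by case/andP=> -> /IH.
have [wp ew] := walk_rcons _ _ _ (let: And3 h _ _ := and3P gp in h).
have wK : last z (unzip2 p) \notin K by apply: pK'; apply: mem_last.
have [fv fw _] := level_boundary (etrans (joins_sym _ _ _) ew) vK wK.
have bP e' : e' \in path_edges (rcons p (e, v)) -> e' \in boundary K -> e' = e.
  rewrite inE /unzip1 map_rcons mem_rcons inE => /predU1P[//|e'p].
  case/boundaryP => x [y [exy xK _]].
  have /pK' : x \in z :: unzip2 p.
    apply: walk_ends wp e'p _ _.
    by rewrite (joins_ends _ exy) eqxx (negbTE (joins_neq exy)).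
  by rewrite xK.
have sP : path_edges (rcons p (e, v)) \subset F :+: Fk.
  by apply/subsetP => e'; rewrite inE => /pD.
have cP := card_symdiff_exchange sP.
have h1 : is_join (Q ~+ v) (F :+: path_edges (rcons p (e, v))).
  by apply: join_eq (join_path hF gp) _; xor_eq.
have h2 : is_join (Q ~+ z ~+ v ~+ k) (Fk :+: path_edges (rcons p (e, v))).
  by apply: join_eq (join_path hFk gp) _; xor_eq.
have lk := level_triple vK kK fv h2.
have /level_inside noK : v \in K by [].
(* By the inequality, [Fk] switched along the path has at least [f z + f k - f v] edges, which
   leaves at most [f v] for [F] switched along it. *)
have h3 : min_join (Q ~+ v) (F :+: path_edges (rcons p (e, v))).
  apply/min_joinP; split=> //; apply/eqP; rewrite eqn_leq nu_le // andbT.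
  rewrite -/(f v); rewrite -/(f z) in cF; rewrite -/(f k) in cFk.
  by move: cP lk cF cFk; clear; lia.
have bF e' : e' \in boundary K -> (e' \in F) = (e' \in path_edges (rcons p (e, v))).
  move=> e'K; have := noK _ h3 e'; rewrite in_symdiff e'K /=.
  by case: (e' \in F); case: (e' \in _) => // /(_ isT).
exists e, v, (last z (unzip2 p)); split=> //.
- by rewrite joins_sym.
- rewrite bF; first by rewrite inE /unzip1 map_rcons mem_rcons inE eqxx.
  by apply/boundaryP; exists v, (last z (unzip2 p)); rewrite joins_sym.
- by move=> e' e'F e'K; apply: bP; rewrite // -bF.
Qed.

End Level.

End Joins.

Section Structure.
Variable G : multigraph.
Local Notation V := (vertex G).
Local Notation E := (edge G).
Implicit Types (x y z r s u v a b : V) (e : E) (X K C U W Q T A B S : {set V}).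
Implicit Types (F J D : {set E}) (p : seq (E * V)).

(** * Exchanging the parts of two joins inside a vertex set *)

Definition inner_edges K : {set E} := [set e | ends e \subset K].

Lemma join_restrict K U F : is_join U F -> {in F, forall e, e \notin boundary K} ->
  is_join (U :&: K) (F :&: inner_edges K).
Proof.
move=> /joinP hF nb; apply/joinP => v; rewrite inE -hF andbC.
case vK: (v \in K) => /=; last first.
  rewrite /degree (_ : [set _ in _ | _] = set0) ?cards0 //; apply/setP => e.
  rewrite !inE; apply/negP => /andP[/andP[_ /subsetP eK] /eK].
  by rewrite vK.
congr odd; apply: eq_card => e; rewrite !inE.
case eF: (e \in F) => //=; case ve: (v \in ends e); rewrite ?andbF // andbT.
apply/subsetP => w we; apply/negPn/negP => wK.
case/negP: (nb _ eF); apply/boundaryP; exists v, w; split=> //.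
rewrite /joins eq_sym eqEcard subUset !sub1set ve we card_ends cards2.
by case: (v =P w) => // vw; rewrite -vw vK in wK.
Qed.

(** [D] is the difference of the two parts inside [K]; adding it to both joins exchanges these
    parts, so the total size is kept. *)
Lemma join_swap K U W F F' : is_join U F -> is_join W F' ->
  {in F, forall e, e \notin boundary K} -> {in F', forall e, e \notin boundary K} ->
  exists D, [/\ D \subset F :+: F', D \subset inner_edges K,
    is_join ((U :+: W) :&: K) D & #|F :+: D| + #|F' :+: D| = #|F| + #|F'|].
Proof.
move=> hF hF' nb nb'.
exists ((F :&: inner_edges K) :+: (F' :&: inner_edges K)); split.
- apply/subsetP => e; rewrite !in_symdiff !in_setI.
  by case: (e \in F); case: (e \in F'); case: (e \in _).
- by apply/subsetP => e; rewrite !in_symdiff !in_setI; case: (e \in inner_edges _);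
    rewrite ?andbF.
- apply: join_eq (join_symdiff (join_restrict hF nb) (join_restrict hF' nb')) _.
  by apply/setP => v; rewrite !(in_setI, in_symdiff); case: (v \in K); rewrite ?andbT ?andbF.
- apply: card_symdiff_exchange; apply/subsetP => e; rewrite !in_symdiff !in_setI.
  by case: (e \in F); case: (e \in F'); case: (e \in _).
Qed.

Lemma boundary_setC K : boundary (~: K) = boundary K.
Proof.
apply/setP => e; apply/boundaryP/boundaryP => -[x [y [exy]]].
  by rewrite !inE negbK => xK yK; exists y, x; rewrite joins_sym.
by move=> xK yK; exists y, x; rewrite joins_sym !inE negbK.
Qed.

Lemma ends_boundary K e x y : joins e x y -> x \in K -> y \notin K -> e \in boundary K.
Proof. by move=> exy xK yK; apply/boundaryP; exists x, y. Qed.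

(* Removing its only boundary edge turns a minimum join into one which can be
   swapped inside [K]. *)
Lemma only_boundary F K e : (forall e', e' \in F -> e' \in boundary K -> e' = e) ->
  e \in F -> {in F ~+ e, forall e', e' \notin boundary K}.
Proof.
move=> only eF e'; rewrite in_symdiff inE; case: (e' =P e) => [->|ne]; first by rewrite eF.
by rewrite addbF => e'F; apply/negP => /(only _ e'F).
Qed.

Lemma ends_eq e x y x' y' K : joins e x y -> joins e x' y' ->
  x \in K -> y \notin K -> x' \in K -> y' \notin K -> x = x' /\ y = y'.
Proof.
move=> exy exy' xK yK x'K y'K.
have := joins_ends x exy; have := joins_ends y exy.
rewrite (joins_ends x exy') (joins_ends y exy') !eqxx.
have -> : (x == y') = false by apply/eqP => h; rewrite -h xK in y'K.
have -> : (y == x') = false by apply/eqP => h; rewrite h x'K in yK.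
rewrite [y == x]eq_sym (negbTE (joins_neq exy)) /=.
by case: (y =P y') => // ->; case: (x =P x') => // ->.
Qed.

(** * Factor-connected vertices and the ends of boundary edges *)

Section Classes.
Variable T : {set V}.

Lemma allowed_adj_sym : symmetric (allowed_adj T).
Proof. by move=> x y; apply/eq_existsb => e; rewrite joins_sym. Qed.

Lemma factor_connected_sym u v : factor_connected T u v = factor_connected T v u.
Proof. exact: (sym_connect_sym allowed_adj_sym). Qed.

Lemma factor_component_ex u v :
  [exists C, [&& factor_component T C, u \in C & v \in C]] = factor_connected T u v.
Proof.
apply/existsP/idP => [[C /and3P[/maxsetP[hC _] uC vC]] | uv].
  by move/forall_inP/(_ _ uC)/forall_inP/(_ _ vC): hC.
have [|C hC] := @maxset_exists _ (fun C' : {set V} =>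
    [forall u in C', forall v in C', factor_connected T u v]) [set u; v].
  apply/forall_inP => x; rewrite !inE => /orP[] /eqP ->;
  apply/forall_inP => y; rewrite !inE => /orP[] /eqP -> //; try exact: connect0.
  by rewrite factor_connected_sym.
rewrite subUset !sub1set => /andP[uC vC].
by exists C; rewrite /factor_component hC uC vC.
Qed.

(** In the definition [[set u; v]] collapses to one vertex when [u = v]; toggling [u] and [v] one
    after the other gives back [T], which absorbs that case. *)
Lemma equiv_verticesE u v : equiv_vertices T u v =
  factor_connected T u v && (nu T == nu (T ~+ u ~+ v)).
Proof.
rewrite /equiv_vertices factor_component_ex.
have [<-|uv] := eqVneq u v.
  by rewrite symdiffK eqxx andbT /factor_connected connect0.
congr (_ && (_ == nu _)); apply/setP => x; rewrite !(in_symdiff, inE).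
case: (x =P u) => [->|_]; last by rewrite addbF.
by rewrite (negbTE uv) addbF.
Qed.

Lemma factor_connected_exit u v K : factor_connected T u v -> u \in K -> v \notin K ->
  exists e x y, [/\ allowed T e, joins e x y, x \in K, y \notin K & factor_connected T u x].
Proof.
move=> /connectP[q]; elim: q u => [|w q IH] u /=; first by move=> _ -> ->.
case/andP=> uw pq vq uK vK; have [wK|wK] := boolP (w \in K).
  have [e [x [y [ae exy xK yK wx]]]] := IH _ pq vq wK vK.
  by exists e, x, y; split=> //; apply: connect_trans (connect1 uw) wx.
case/existsP: uw => e /andP[ae euw].
by exists e, u, w; split=> //; apply: connect0.
Qed.

Lemma allowedP e : reflect (exists2 F, min_join T F & e \in F) (allowed T e).
Proof. by apply: (iffP exists_inP). Qed.

Lemma join_factor_connected D x y : is_join ([set x] ~+ y) D ->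
  {in D, forall e, allowed T e} -> feasible T -> factor_connected T x y.
Proof.
move=> hD aD /nu_join[F hF cF].
have [|p [/and3P[wp _ /eqP <-] pD _]] := @path_of_join _ T F D x y _ hD.
  by apply/min_joinP.
elim: p x {hD} wp pD => [|[e w] p IH] x /=; first by rewrite /factor_connected connect0.
case/andP=> exw wp pD; apply: (connect_trans (y := w)).
  apply: connect1; apply/existsP; exists e; rewrite exw andbT.
  by apply: aD; apply: pD; rewrite inE eqxx.
by apply: IH => // e' e'p; apply: pD; rewrite inE e'p orbT.
Qed.

(** Without their boundary edges, the two joins can exchange their parts inside [K]; the difference
    [D] consists of allowed edges and links [x] to [x']. The exchanged sets have [2 * nu T - 2]
    edges in all, so one has at most [nu T - 1]; toggling its boundary edge then gives a join for
    [T ~+ x ~+ x']. *)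
Lemma boundary_ends_equiv K F F' e e' x y x' y' :
  min_join T F -> min_join T F' ->
  (forall e1, e1 \in F -> e1 \in boundary K -> e1 = e) ->
  (forall e1, e1 \in F' -> e1 \in boundary K -> e1 = e') ->
  e \in F -> e' \in F' -> joins e x y -> joins e' x' y' ->
  x \in K -> y \notin K -> x' \in K -> y' \notin K ->
  factor_connected T x x' /\ nu (T ~+ x ~+ x') <= nu T.
Proof.
move=> mF mF' oF oF' eF eF' exy exy' xK yK x'K y'K.
have [[hF cF] [hF' cF']] := (min_joinP _ _ mF, min_joinP _ _ mF').
have [D [sD _ hD cD]] := join_swap (join_edge exy hF) (join_edge exy' hF')
  (only_boundary oF eF) (only_boundary oF' eF').
have {}hD : is_join ([set x] ~+ x') D.
  apply: join_eq hD _; apply/setP => v; rewrite !(in_setI, in_symdiff, in_set1).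
  have [-> | vx] := eqVneq v x.
    have -> : (x == y) = false by apply/eqP => h; rewrite -h xK in yK.
    have -> : (x == y') = false by apply/eqP => h; rewrite -h xK in y'K.
    by rewrite xK; case: (x \in T); case: (x == x').
  have [-> | vx'] := eqVneq v x'.
    have -> : (x' == y) = false by apply/eqP => h; rewrite -h x'K in yK.
    have -> : (x' == y') = false by apply/eqP => h; rewrite -h x'K in y'K.
    by rewrite x'K; case: (x' \in T).
  have [-> | vy] := eqVneq v y; first by rewrite (negbTE yK) andbF.
  have [-> | vy'] := eqVneq v y'; first by rewrite (negbTE y'K) andbF.
  by case: (v \in T).
split.
  apply: join_factor_connected hD _ (feasible_join hF) => e1 /(subsetP sD).
  move=> e1D; apply/allowedP; have : (e1 \in F) || (e1 \in F').
    move: e1D; rewrite !in_symdiff !inE.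
    case: (e1 =P e) => [->|_]; first by rewrite eF.
    case: (e1 =P e') => [->|_]; first by rewrite eF' orbT.
    by case: (e1 \in F); case: (e1 \in F').
  by case/orP; [exists F | exists F'].
have /nu_le l1 : is_join (T ~+ x ~+ x') (F ~+ e :+: D ~+ e).
  by apply: join_eq (join_edge exy (join_symdiff (join_edge exy hF) hD)) _; xor_eq.
have /nu_le l2 : is_join (T ~+ x ~+ x') (F' ~+ e' :+: D ~+ e').
  by apply: join_eq (join_edge exy' (join_symdiff (join_edge exy' hF') hD)) _; xor_eq.
have := card_symdiff_le (F ~+ e :+: D) e; have := card_symdiff_le (F' ~+ e' :+: D) e'.
have := card_symdiff_in eF; have := card_symdiff_in eF'.
by move: l1 l2 cD cF cF'; clear; lia.
Qed.

End Classes.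

(** * Connected components of induced subgraphs *)

Definition component_of X x : {set V} :=
  [set y | connect [rel a b | [&& a \in X, b \in X & adj a b]] x y].

Lemma adj_sym : symmetric (@adj G).
Proof. by move=> x y; apply/eq_existsb => e; rewrite joins_sym. Qed.

Lemma connect_in_sym X : connect_sym [rel a b | [&& a \in X, b \in X & adj a b]].
Proof.
by apply: sym_connect_sym => a b /=; rewrite andbCA adj_sym.
Qed.

Lemma connect_in_mem X x y : x \in X ->
  connect [rel a b | [&& a \in X, b \in X & adj a b]] x y -> y \in X.
Proof.
move=> xX /connectP[q]; elim: q x xX => [|w q IH] x xX /=; first by move=> _ ->.
by case/andP=> /and3P[_ wX _] /IH; apply.
Qed.

Lemma component_of_in X x : x \in X -> component_of X x \in components X.
Proof. by move=> xX; apply/imsetP; exists x. Qed.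

Lemma component_of_mem X x : x \in component_of X x.
Proof. by rewrite inE connect0. Qed.

Lemma component_eq X C x : C \in components X -> x \in C -> C = component_of X x.
Proof.
case/imsetP=> w wX -> ; rewrite !inE => wx; apply/setP => y; rewrite !inE.
exact: (same_connect (connect_in_sym X) wx).
Qed.

Lemma component_sub X C : C \in components X -> C \subset X.
Proof.
case/imsetP=> w wX ->; apply/subsetP => y; rewrite inE; exact: connect_in_mem.
Qed.

Lemma component_ex X C : C \in components X -> exists x, x \in C.
Proof. by case/imsetP=> w wX ->; exists w; apply: component_of_mem. Qed.

Lemma component_closed X C x y :
  C \in components X -> x \in C -> y \in X -> adj x y -> y \in C.
Proof.
move=> hC xC yX xy; rewrite (component_eq hC xC) inE; apply: connect1.
by rewrite /= xy yX (subsetP (component_sub hC)).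
Qed.

Lemma component_connected X C : C \in components X -> connected_in C.
Proof.
move=> hC x y xC; rewrite {1}(component_eq hC xC) inE => /connectP[q].
elim: q x xC => [|w q IH] x xC /=; first by move=> _ ->.
case/andP=> /and3P[_ wX xw] pq yq.
have wC := component_closed hC xC wX xw.
apply: connect_trans (IH _ wC pq yq); apply: connect1.
by rewrite /= xC wC.
Qed.

Lemma component_level Q m K : bipartite G ->
  K \in components [set x | feasible (Q ~+ x) && (potential Q x <= m)] ->
  level_component Q m K.
Proof.
move=> bip hK; have sK := subsetP (component_sub hK); split.
- by move=> x /sK; rewrite inE => /andP.
- exact: component_connected hK.
- move=> e x y exy xK yK; rewrite ltnNge; apply/negP => fy.
  have := sK _ xK; rewrite inE => /andP[fx _].
  have [fy' _] := potential_adj bip exy fx.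
  case/negP: yK; apply: component_closed hK xK _ _; first by rewrite inE fy' fy.
  by apply/existsP; exists e.
Qed.

(** * Equivalent vertices and the vertex classes *)

Section Equivalence.
Variable T : {set V}.
Hypothesis bip : bipartite G.
Hypothesis feasT : feasible T.

Let own_level u :=
  component_of [set x | feasible (T ~+ u ~+ x) && (potential (T ~+ u) x <= nu T)] u.

(* By [level_inside], no allowed edge leaves the component of [u] in the set of
   vertices at distance at most 0 from [u]. *)
Lemma factor_connected_level u v : factor_connected T u v ->
  [/\ level_component (T ~+ u) (nu T) (own_level u), u \in own_level u & v \in own_level u].
Proof.
move=> uv.
have lK : level_component (T ~+ u) (nu T) (own_level u).
  apply: component_level bip _; apply: component_of_in.
  by rewrite inE /potential symdiffK feasT leqnn.
have uK : u \in own_level u by apply: component_of_mem.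
split=> //; apply/negPn/negP => vK.
have [e [x [y [/allowedP[F mF eF] exy xK yK _]]]] := factor_connected_exit uv uK vK.
have mF' : min_join (T ~+ u ~+ u) F by rewrite symdiffK.
by have := level_inside bip lK uK mF' eF; rewrite (ends_boundary exy).
Qed.

Lemma factor_connected_nu u v : factor_connected T u v -> nu (T ~+ u ~+ v) <= nu T.
Proof. by case/factor_connected_level => -[fK _ _] _ /fK[]. Qed.

(** Measured from [u], both [u] and [v] have the top value [nu T] of the level component of [u], so
    they cancel in the inequality at [w]. *)
Lemma equiv_nu_le u v w : equiv_vertices T u v -> feasible (T ~+ v ~+ w) ->
  nu (T ~+ u ~+ w) <= nu (T ~+ v ~+ w).
Proof.
rewrite equiv_verticesE => /andP[uv /eqP nuv] /nu_join[J hJ <-].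
have [lK uK vK] := factor_connected_level uv.
have hJ' : is_join (T ~+ u ~+ w ~+ v ~+ u) J by apply: join_eq hJ _; xor_eq.
have := level_triple bip lK vK uK (esym nuv) hJ'.
rewrite /potential symdiffK -nuv; lia.
Qed.

Lemma equiv_sym u v : equiv_vertices T u v = equiv_vertices T v u.
Proof.
rewrite !equiv_verticesE factor_connected_sym.
by have -> : T ~+ u ~+ v = T ~+ v ~+ u by xor_eq.
Qed.

Lemma factor_connected_feasible u v w : factor_connected T u v ->
  feasible (T ~+ u ~+ w) -> feasible (T ~+ v ~+ w).
Proof.
move=> /factor_connected_level[[fK _ _] _ /fK[/existsP[J hJ] _]] /existsP[J' hJ'].
case/existsP: feasT => F hF.
by apply: feasible_join (join_eq (join_symdiff (join_symdiff hJ hJ') hF) _); xor_eq.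
Qed.

Lemma equiv_nu u v w : equiv_vertices T u v -> feasible (T ~+ u ~+ w) ->
  nu (T ~+ u ~+ w) = nu (T ~+ v ~+ w).
Proof.
move=> uv fu; have : factor_connected T u v by move: uv; rewrite equiv_verticesE => /andP[].
move=> /factor_connected_feasible/(_ fu) fv.
have vu : equiv_vertices T v u by rewrite equiv_sym.
by apply/eqP; rewrite eqn_leq; apply/andP; split; apply: equiv_nu_le.
Qed.

Lemma equiv_refl u : equiv_vertices T u u.
Proof. by rewrite /equiv_vertices eqxx. Qed.

Lemma equiv_trans u v w :
  equiv_vertices T u v -> equiv_vertices T v w -> equiv_vertices T u w.
Proof.
move=> uv vw; move: (uv) (vw); rewrite !equiv_verticesE => /andP[cuv _] /andP[cvw /eqP nvw].
have cuw : factor_connected T u w := connect_trans cuv cvw.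
rewrite cuw /= nvw eq_sym (equiv_nu uv) //.
by have [[fK _ _] _ /fK[]] := factor_connected_level cuw.
Qed.

Lemma class_equiv S u v : S \in vertex_classes T -> u \in S -> v \in S -> equiv_vertices T u v.
Proof.
case/imsetP=> w _ ->; rewrite !inE => wu wv; apply: equiv_trans wv.
by rewrite equiv_sym.
Qed.

Lemma class_closed S u v : S \in vertex_classes T -> u \in S -> equiv_vertices T u v -> v \in S.
Proof. by case/imsetP=> w _ ->; rewrite !inE => wu; apply: equiv_trans. Qed.

Lemma class_inj S S' u : S \in vertex_classes T -> S' \in vertex_classes T ->
  u \in S -> u \in S' -> S = S'.
Proof.
move=> hS hS' uS uS'; apply/setP => v; apply/idP/idP => h.
  by apply: class_closed hS' uS' (class_equiv hS uS h).
by apply: class_closed hS uS (class_equiv hS' uS' h).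
Qed.

Lemma class_ex u : exists2 S, S \in vertex_classes T & u \in S.
Proof.
exists [set v | equiv_vertices T u v]; first exact: imset_f.
by rewrite inE equiv_refl.
Qed.

(** Ensures that the default [set0] in [root_class] and [antiroot_class] is not taken. *)
Lemma pick_class X u : u \in X -> {in X, forall v, equiv_vertices T u v} ->
  let S := odflt set0 [pick S in vertex_classes T | X \subset S] in
  S \in vertex_classes T /\ X \subset S.
Proof.
move=> uX uv; case: pickP => [S /andP[]//|] /=.
have [S hS uS] := class_ex u => /(_ S); rewrite hS => /negbT /subsetPn[v vX].
by rewrite (class_closed hS uS (uv _ vX)).
Qed.

End Equivalence.

(** * Decapital components: root class, antiroot class and inner exchange *)

Section Decapital.
Variables (T : {set V}) (r : V).
Hypothesis bip : bipartite G.
Hypothesis feasT : feasible T.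
Local Notation Q := (T ~+ r).
Local Notation f := (potential Q).

Section Component.
Variables (K : {set V}) (m : nat) (k : V).
Hypothesis lvlK : level_component Q m K.
Hypothesis kK : k \in K.
Hypothesis rK : r \notin K.

Lemma decapital_edge F : min_join T F ->
  exists e x y, [/\ joins e x y, x \in K, y \notin K, e \in F &
    forall e', e' \in F -> e' \in boundary K -> e' = e].
Proof. by move=> mF; apply: (level_outside bip lvlK kK rK); rewrite symdiffK. Qed.

Lemma decapital_only F e x y : min_join T F -> e \in F -> joins e x y ->
  x \in K -> y \notin K -> forall e', e' \in F -> e' \in boundary K -> e' = e.
Proof.
move=> mF eF exy xK yK; have [e0 [x0 [y0 [_ _ _ _ only]]]] := decapital_edge mF.
by move=> e' e'F /(only _ e'F) ->; rewrite (only e) // (ends_boundary exy).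
Qed.

(** In the inequality at [z = r] the equal values of [x] and [s] cancel, and [f r = nu T]. Hence top
    vertices are at nonnegative distance from each other. *)
Lemma top_nu_ge x s : x \in K -> s \in K -> f x = m -> f s = m ->
  forall J, is_join (T ~+ x ~+ s) J -> nu T <= #|J|.
Proof.
move=> xK sK fx fs J hJ.
have hJ' : is_join (Q ~+ r ~+ x ~+ s) J by rewrite symdiffK.
have := level_triple bip lvlK xK sK fx hJ'.
by rewrite fx fs leq_add2r /potential symdiffK.
Qed.

Lemma top_equiv x s : x \in K -> s \in K -> f x = m -> f s = m ->
  factor_connected T x s -> equiv_vertices T x s.
Proof.
move=> xK sK fx fs xs; rewrite equiv_verticesE xs eqn_leq factor_connected_nu // andbT.
have [[fL _ _] _ /fL[/nu_join[J hJ <-] _]] := factor_connected_level bip feasT xs.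
exact: top_nu_ge hJ.
Qed.

Lemma inner_ends_equiv e x y e' x' y' : allowed T e -> allowed T e' ->
  joins e x y -> joins e' x' y' ->
  x \in K -> y \notin K -> x' \in K -> y' \notin K -> equiv_vertices T x x'.
Proof.
move=> /allowedP[F mF eF] /allowedP[F' mF' eF'] exy exy' xK yK x'K y'K.
have [fx _ _] := level_boundary bip lvlK exy xK yK.
have [fx' _ _] := level_boundary bip lvlK exy' x'K y'K.
have [xx' _] := boundary_ends_equiv mF mF' (decapital_only mF eF exy xK yK)
  (decapital_only mF' eF' exy' x'K y'K) eF eF' exy exy' xK yK x'K y'K.
exact: top_equiv.
Qed.

(** Applying [boundary_ends_equiv] to the complement of [K] gives all but the lower bound. For that,
    [y] and [y'] are linked through [K] inside the level set at [m.+1], on whose top they lie, and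
    the inequality at [z = r] applies. *)
Lemma outer_ends_equiv e x y e' x' y' : allowed T e -> allowed T e' ->
  joins e x y -> joins e' x' y' ->
  x \in K -> y \notin K -> x' \in K -> y' \notin K -> equiv_vertices T y y'.
Proof.
move=> /allowedP[F mF eF] /allowedP[F' mF' eF'] exy exy' xK yK x'K y'K.
have [fx fy fey] := level_boundary bip lvlK exy xK yK.
have [fx' fy' _] := level_boundary bip lvlK exy' x'K y'K.
have oF := decapital_only mF eF exy xK yK.
have oF' := decapital_only mF' eF' exy' x'K y'K.
have [||||||||yy' le] := @boundary_ends_equiv T (~: K) F F' e e' y x y' x' mF mF' _ _ eF eF';
  rewrite ?boundary_setC ?(joins_sym _ y) ?(joins_sym _ y') ?inE ?negbK //.
rewrite equiv_verticesE yy' eqn_leq le andbT.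
have [[fL _ _] _ /fL[/nu_join[J hJ <-] _]] := factor_connected_level bip feasT yy'.
have hJ' : is_join (Q ~+ r ~+ y ~+ y') J by rewrite symdiffK.
have := potential_triple bip fey _ hJ'.
rewrite fy fy' leq_add2r /potential symdiffK; apply; rewrite -/(f _).
case: lvlK => fK cK _.
have st a b d : joins d a b -> f a <= m.+1 -> f b <= m.+1 ->
    connect [rel a b | [&& f a <= m.+1, f b <= m.+1 & adj a b]] a b.
  move=> dab fa fb; apply: connect1; rewrite /= fa fb; apply/existsP; by exists d.
apply: (connect_trans (y := x)).
  by apply: (st _ _ e); rewrite ?fx ?fy // joins_sym.
apply: (connect_trans (y := x')); last by apply: (st _ _ e'); rewrite ?fx' ?fy'.
apply: connect_sub (cK _ _ xK x'K) => a b /and3P[aK bK ab]; apply: connect1.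
have [_ la] := fK _ aK; have [_ lb] := fK _ bK.
by rewrite /= ab (leqW la) (leqW lb).
Qed.

Lemma inner_endsP x : reflect (exists e y, [/\ allowed T e, joins e x y, x \in K & y \notin K])
  (x \in inner_ends T K).
Proof.
apply: (iffP bigcupP) => [[e /andP[eK ae]] | [e [y [ae exy xK yK]]]].
  rewrite inE => /andP[xe xK]; case/boundaryP: eK => x' [y [exy x'K yK]].
  exists e, y; split=> //; move: xe; rewrite (joins_ends x exy).
  by case: (x =P x') => [->|] //= _ /eqP xy; rewrite -xy xK in yK.
exists e; first by rewrite ae andbT (ends_boundary exy).
by rewrite inE xK (joins_ends x exy) eqxx (negbTE (joins_neq exy)).
Qed.

Lemma outer_endsP y : reflect (exists e x, [/\ allowed T e, joins e x y, x \in K & y \notin K])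
  (y \in outer_ends T K).
Proof.
apply: (iffP bigcupP) => [[e /andP[eK ae]] | [e [x [ae exy xK yK]]]].
  rewrite inE => /andP[yK ye]; case/boundaryP: eK => x [y' [exy xK y'K]].
  exists e, x; split=> //; move: ye; rewrite (joins_ends y exy).
  case: (y =P x) => [yx|] /=; first by rewrite yx xK in yK.
  by move=> _ /eqP ->.
exists e; first by rewrite ae andbT (ends_boundary exy).
by rewrite inE yK (joins_ends y exy) eqxx eq_sym (negbTE (joins_neq exy)).
Qed.

Lemma allowed_min_join F e : min_join T F -> e \in F -> allowed T e.
Proof. by move=> mF eF; apply/allowedP; exists F. Qed.

Lemma root_classP : root_class T K \in vertex_classes T /\
  inner_ends T K \subset root_class T K.
Proof.
have [F hF cF] := nu_join feasT; have mF : min_join T F by apply/min_joinP.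
have [e [x [y [exy xK yK /(allowed_min_join mF) ae _]]]] := decapital_edge mF.
apply: (@pick_class T bip feasT _ x); first by apply/inner_endsP; exists e, y.
by move=> x' /inner_endsP[e' [y' [ae' exy' x'K y'K]]]; apply: inner_ends_equiv exy exy' _ _ _ _.
Qed.

Lemma antiroot_classP : antiroot_class T K \in vertex_classes T /\
  outer_ends T K \subset antiroot_class T K.
Proof.
have [F hF cF] := nu_join feasT; have mF : min_join T F by apply/min_joinP.
have [e [x [y [exy xK yK /(allowed_min_join mF) ae _]]]] := decapital_edge mF.
apply: (@pick_class T bip feasT _ y); first by apply/outer_endsP; exists e, x.
by move=> y' /outer_endsP[e' [x' [ae' exy' x'K y'K]]]; apply: outer_ends_equiv exy exy' _ _ _ _.
Qed.

Lemma class_potential S x y : S \in vertex_classes T -> x \in S -> y \in S ->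
  feasible (Q ~+ x) -> feasible (Q ~+ y) /\ f y = f x.
Proof.
move=> hS xS yS fx; have xy := class_equiv bip feasT hS xS yS.
have E1 w : Q ~+ w = T ~+ w ~+ r by xor_eq.
rewrite /potential !E1 in fx *; split; last by rewrite (equiv_nu bip feasT xy fx).
apply: (factor_connected_feasible bip feasT) fx.
by move: xy; rewrite equiv_verticesE => /andP[].
Qed.

Lemma root_class_potential x : x \in root_class T K -> feasible (Q ~+ x) /\ f x = m.
Proof.
have [hS /subsetP sS] := root_classP => xS.
have [F hF cF] := nu_join feasT; have mF : min_join T F by apply/min_joinP.
have [e [a [b [eab aK bK /(allowed_min_join mF) ae _]]]] := decapital_edge mF.
have [fa _ _] := level_boundary bip lvlK eab aK bK.
rewrite -fa; apply: class_potential hS _ xS _.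
  by apply: sS; apply/inner_endsP; exists e, b.
by case: lvlK => fK _ _; have [] := fK _ aK.
Qed.

Lemma antiroot_class_potential y : y \in antiroot_class T K -> f y = m.+1.
Proof.
have [hS /subsetP sS] := antiroot_classP => yS.
have [F hF cF] := nu_join feasT; have mF : min_join T F by apply/min_joinP.
have [e [a [b [eab aK bK /(allowed_min_join mF) ae _]]]] := decapital_edge mF.
have [_ fb feb] := level_boundary bip lvlK eab aK bK.
have [|_ ->//] := class_potential hS _ yS feb.
by apply: sS; apply/outer_endsP; exists e, a.
Qed.

(** [F] without [e] and a minimum join for [Q ~+ x] have no boundary edges, so they can exchange
    their parts inside [K]. The latter becomes a join for [Q ~+ a] and has at least [f a] edges;
    hence moving from [a] to [x] inside [K] costs [F] at most [f x - f a]. *)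
Lemma inner_exchange F e a b x : min_join T F -> e \in F -> joins e a b ->
  a \in K -> b \notin K -> x \in K ->
  exists D, [/\ D \subset inner_edges K, is_join ([set a] ~+ x) D &
    #|F :+: D| + f a <= #|F| + f x].
Proof.
move=> mF eF eab aK bK xK; have [hF cF] := min_joinP _ _ mF.
have [fx _] : feasible (Q ~+ x) /\ f x <= m by case: lvlK => fK _ _; apply: fK.
have [Fx hFx cFx] := nu_join fx.
have mFx : min_join (Q ~+ x) Fx by apply/min_joinP.
have [D [_ sD hD cD]] := join_swap (join_edge eab hF) hFx
  (only_boundary (decapital_only mF eF eab aK bK) eF) (level_inside bip lvlK xK mFx).
have {}hD : is_join ([set a] ~+ x) D.
  apply: join_eq hD _; apply/setP => v; rewrite !(in_setI, in_symdiff, in_set1).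
  have [-> | vb] := eqVneq v b.
    have -> : (b == a) = false by apply/eqP => h; rewrite -h (negbTE bK) in aK.
    have -> : (b == x) = false by apply/eqP => h; rewrite -h (negbTE bK) in xK.
    by rewrite (negbTE bK) andbF.
  have [-> | vr] := eqVneq v r.
    have -> : (r == a) = false by apply/eqP => h; rewrite -h (negbTE rK) in aK.
    have -> : (r == x) = false by apply/eqP => h; rewrite -h (negbTE rK) in xK.
    by rewrite (negbTE rK) andbF.
  have [->|_] := eqVneq v a; first by rewrite aK; case: (a \in T); case: (a == x).
  have [->|_] := eqVneq v x; first by rewrite xK; case: (x \in T).
  by case: (v \in T).
exists D; split=> //.
have /nu_le : is_join (Q ~+ a) (Fx :+: D).
  by apply: join_eq (join_symdiff hFx hD) _; xor_eq.
have eD : e \notin D.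
  apply/negP => /(subsetP sD); rewrite inE => /subsetP /(_ b).
  by rewrite (joins_ends _ eab) eqxx eq_sym (negbTE (joins_neq eab)) (negbTE bK) => /(_ isT).
have : (#|F ~+ e :+: D|).+1 = #|F :+: D|.
  have -> : F ~+ e :+: D = F :+: D ~+ e by xor_eq.
  by apply: card_symdiff_in; rewrite in_symdiff eF (negbTE eD).
have := card_symdiff_in eF; rewrite -/(f a); rewrite -/(f x) in cFx.
by move: cD cFx; clear; lia.
Qed.

End Component.
End Decapital.

(** * Paths and distances in terms of joins *)

Lemma negative_path_join T F x p y : min_join T F -> gpath x p y -> (weight F p < 0)%R ->
  exists2 J, is_join (T ~+ x ~+ y) J & #|J| < nu T.
Proof.
move=> /min_joinP[hF <-] gp wp; exists (F :+: path_edges p); first exact: join_path.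
by have := card_path F gp; move: wp; clear; lia.
Qed.

(** Switching [F] along a path changes its size by the weight, and [path_of_join] turns a minimum
    join for [T ~+ r ~+ x] into an optimal path. As [F] is absent from the right-hand side,
    distances do not depend on the minimum join. *)
Lemma is_distE T F r x (d : int) : min_join T F ->
  is_dist F r x d <-> feasible (T ~+ r ~+ x) /\ (d = (nu (T ~+ r ~+ x))%:Z - (nu T)%:Z)%R.
Proof.
move=> mF; have [hF cF] := min_joinP _ _ mF.
have lo p : gpath r p x -> ((nu (T ~+ r ~+ x))%:Z - (nu T)%:Z <= weight F p)%R.
  move=> gp; have := nu_le (join_path hF gp); have := card_path F gp.
  by rewrite -cF; clear; lia.
have ex : feasible (T ~+ r ~+ x) -> exists2 p, gpath r p x &
    weight F p = ((nu (T ~+ r ~+ x))%:Z - (nu T)%:Z)%R.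
  move=> /nu_join[J hJ cJ].
  have hD : is_join ([set r] ~+ x) (F :+: J).
    by apply: join_eq (join_symdiff hF hJ) _; xor_eq.
  have [p [gp _ wp]] := path_of_join mF hD.
  exists p => //; have := lo _ gp; move: wp.
  have -> : F :+: (F :+: J) = J by xor_eq.
  by rewrite cF cJ; clear; lia.
split=> [[[p gp wp] hmin] | [fx ->]]; last by split; [apply: ex | apply: lo].
have fx : feasible (T ~+ r ~+ x) by apply: feasible_join (join_path hF gp).
split=> //; have [p' gp' wp'] := ex fx.
by have := hmin _ gp'; have := lo _ gp; move: wp wp'; clear; lia.
Qed.

Lemma connect_walk (R : rel V) x p y : gpath x p y ->
  {in x :: unzip2 p &, forall a b, adj a b -> R a b} -> connect R x y.
Proof.
elim: p x => [|[e w] p IH] x; first by rewrite /gpath /= => /eqP ->.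
rewrite gpath_cons => /and3P[exw _ gp] hR.
apply: (connect_trans (y := w)).
  apply: connect1; apply: hR; rewrite ?inE ?eqxx ?orbT //.
  by apply/existsP; exists e.
by apply: IH => // a b ap bp; apply: hR; rewrite inE ?ap ?bp orbT.
Qed.

Lemma walk_stay (P : pred V) (N : pred E) x p : walk x p -> x \in P ->
  {in unzip1 p, forall e, N e} ->
  (forall e a b, joins e a b -> N e -> a \in P -> b \in unzip2 p -> b \in P) ->
  {subset unzip2 p <= P}.
Proof.
elim: p x => [|[e w] p IH] x //= /andP[exw wp] xP hN hP v.
have wP : w \in P.
  by apply: hP exw _ xP _; rewrite ?hN ?inE ?eqxx.
rewrite inE => /predU1P[->//|]; apply: IH wp wP _ _ v.
  by move=> e' e'p; apply: hN; rewrite inE e'p orbT.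
by move=> e' a b ab Ne aP bp; apply: hP ab Ne aP _; rewrite inE bp orbT.
Qed.

(** * The components of [G[D(K)]] and the families [Ncomps] *)

Section Main.
Variables (T : {set V}) (r : V) (K : {set V}) (m : nat) (k : V) (F0 : {set E}).
Hypothesis bip : bipartite G.
Hypothesis feasT : feasible T.
Local Notation Q := (T ~+ r).
Local Notation f := (potential Q).
Hypothesis lvlK : level_component Q m K.
Hypothesis kK : k \in K.
Hypothesis rK : r \notin K.
Local Notation A := (Apart F0 r K).
Local Notation D := (Dpart F0 r K).
Local Notation AK := (Aclasses T F0 r K).
Local Notation N := (Nset T F0 r K).
Hypothesis inA : forall x, (x \in A) = (x \in K) && (f x == m).

Lemma inD x : (x \in D) = (x \in K) && (f x < m).
Proof.
rewrite inE inA; case xK: (x \in K); rewrite ?andbF //= andbT ltn_neqAle.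
by case: lvlK => fK _ _; have [_ ->] := fK _ xK; rewrite andbT.
Qed.

(** Inner ends of boundary edges of [K] have value [m], above all of [C], so edges leaving [C] stay
    in [K] and end in [A(K)]. The results on decapital components thus apply to [C]. *)
Lemma Dcomponent_level C : C \in components D ->
  [/\ level_component Q m.-1 C, r \notin C &
      forall e x y, joins e x y -> x \in C -> y \notin C -> y \in A].
Proof.
move=> hC; have sC x : x \in C -> x \in K /\ f x < m.
  by move=> /(subsetP (component_sub hC)); rewrite inD => /andP[].
have out e x y : joins e x y -> x \in C -> y \notin C -> y \in A.
  move=> exy xC yC; have [xK fx] := sC _ xC.
  have [yK|yK] := boolP (y \in K).
    apply/negPn/negP => yA; case/negP: yC; apply: component_closed hC xC _ _.
      by rewrite inE yA yK.
    by apply/existsP; exists e.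
  by have [fxm _ _] := level_boundary bip lvlK exy xK yK; rewrite fxm ltnn in fx.
split=> //; last by apply/negP => /sC[]; rewrite (negbTE rK).
split.
- move=> x /sC[xK fx]; case: lvlK => fK _ _; have [fex _] := fK _ xK.
  (* [f x < m] rules out [m = 0], so [m.-1] is a true predecessor. *)
  by split=> //; move: fx; clear; case: (m).
- exact: component_connected hC.
- move=> e x y exy xC yC; have [_ fx] := sC _ xC.
  have := out _ _ _ exy xC yC; rewrite inA => /andP[_ /eqP ->].
  by move: fx; clear; case: (m).
Qed.

Lemma root_classC : root_class T K \in vertex_classes T.
Proof. by have [] := root_classP bip feasT lvlK kK rK. Qed.

Lemma AclassesP S : S \in AK ->
  S = root_fragment T K \/
  [/\ S \in vertex_classes T, S != root_class T K & exists2 x, x \in S & x \in A].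
Proof.
rewrite in_setU1 => /predU1P[->|]; first by left.
rewrite inE in_setD1 => /andP[/andP[SR hS] /set0Pn[x]]; rewrite inE => /andP[xS xA].
by right; split=> //; exists x.
Qed.

(* A class other than the root class which meets [K] cannot leave it: it would
   do so through an allowed edge, whose inner end is in the root class. *)
Lemma Aclasses_top S s : S \in AK -> s \in S -> s \in A.
Proof.
have fK x : x \in K -> feasible (Q ~+ x) by case: lvlK => fK _ _ /fK[].
case/AclassesP => [->|[hS SR [x xS xA]] sS].
  rewrite inE inA => /andP[sR ->]; rewrite /=.
  by have [_ ->] := root_class_potential bip feasT lvlK kK rK sR.
move: (xA); rewrite !inA => /andP[xK /eqP fx].
have [_ fs] := class_potential bip feasT hS xS sS (fK _ xK).
rewrite fs fx eqxx andbT; apply/negPn/negP => sK.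
have : factor_connected T x s.
  by have := class_equiv bip feasT hS xS sS; rewrite equiv_verticesE => /andP[].
case/(factor_connected_exit)/(_ xK sK) => e [a [b [ae eab aK bK xa]]].
have [fa _ _] := level_boundary bip lvlK eab aK bK.
have xea := top_equiv bip feasT lvlK xK aK fx fa xa.
case/eqP: SR; apply: (class_inj bip feasT hS root_classC (u := a)).
  exact: (class_closed bip feasT hS xS xea).
have [_ /subsetP sub] := root_classP bip feasT lvlK kK rK; apply: sub.
by apply/inner_endsP; exists e, b.
Qed.

(** The root fragment may be smaller than its class, but it is the root class cut down to [K], and
    [A(K)] lies in [K]. *)
Lemma Aclasses_closed S s s' : S \in AK -> s \in S -> s' \in A ->
  equiv_vertices T s s' -> s' \in S.
Proof.
case/AclassesP => [->|[hS _ _] sS _]; last exact: (class_closed bip feasT hS sS).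
rewrite inE inA => /andP[sR _] /andP[s'K _] ss'; rewrite inE s'K andbT.
exact: (class_closed bip feasT root_classC sR ss').
Qed.

Lemma Aclasses_inj S S' s s' : S \in AK -> S' \in AK -> s \in S -> s' \in S' ->
  equiv_vertices T s s' -> S = S'.
Proof.
move=> /AclassesP[->|[hS SR _]] /AclassesP[->|[hS' SR' _]] //.
- rewrite inE => /andP[sR _] s'S ss'; case/eqP: SR'; apply/esym.
  by apply: (class_inj bip feasT root_classC hS' _ s'S);
    apply: (class_closed bip feasT root_classC sR).
- move=> sS; rewrite inE => /andP[sR _] ss'; case/eqP: SR.
  by apply: (class_inj bip feasT hS root_classC _ sR);
    apply: (class_closed bip feasT hS sS).
- move=> sS s'S ss'; apply: (class_inj bip feasT hS hS' _ s'S).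
  exact: (class_closed bip feasT hS sS).
Qed.

Lemma Aclasses_cover x : x \in A -> exists2 S, S \in AK & x \in S.
Proof.
move=> xA; have [S hS xS] := class_ex T x.
have [SR|SR] := eqVneq S (root_class T K).
  exists (root_fragment T K); first by rewrite in_setU1 eqxx.
  by rewrite inE -SR xS; move: xA; rewrite inA => /andP[].
exists S => //; rewrite in_setU1 inE in_setD1 SR hS /=; apply/orP; right.
by apply/set0Pn; exists x; rewrite inE xS.
Qed.

Lemma Dcomponent_edge C F : C \in components D -> min_join T F ->
  exists e c s, [/\ joins e c s, c \in C, s \notin C, s \in A & e \in F].
Proof.
move=> hC mF; have [lC rC out] := Dcomponent_level hC.
have [c0 c0C] := component_ex hC.
have [e [c [s [ecs cC sC eF _]]]] := decapital_edge bip lC c0C rC mF.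
by exists e, c, s; split=> //; apply: out ecs cC sC.
Qed.

Lemma Dcomponent_notin C s : C \in components D -> s \in A -> s \notin C.
Proof.
move=> hC; rewrite inA => /andP[_ /eqP fs]; apply/negP => /(subsetP (component_sub hC)).
by rewrite inD fs ltnn andbF.
Qed.

Lemma NcompsP S C : S \in AK -> reflect (C \in components D /\
    exists e c s, [/\ allowed T e, joins e c s, c \in C & s \in S])
  (C \in Ncomps T F0 r K S).
Proof.
move=> hS; rewrite inE; apply: (iffP andP) => -[hC].
  case/exists_inP=> c cC /exists_inP[s sS /existsP[e /andP[ae ecs]]].
  by split=> //; exists e, c, s.
move=> [e [c [s [ae ecs cC sS]]]]; split=> //.
apply/exists_inP; exists c => //; apply/exists_inP; exists s => //.
by apply/existsP; exists e; rewrite ae.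
Qed.

Lemma Dcomponent_outer_equiv C e c s e' c' s' : C \in components D ->
  allowed T e -> allowed T e' -> joins e c s -> joins e' c' s' ->
  c \in C -> c' \in C -> s \in A -> s' \in A -> equiv_vertices T s s'.
Proof.
move=> hC ae ae' ecs ecs' cC c'C sA s'A; have [lC rC _] := Dcomponent_level hC.
exact: (outer_ends_equiv bip feasT lC cC rC ae ae' ecs ecs' cC
  (Dcomponent_notin hC sA) c'C (Dcomponent_notin hC s'A)).
Qed.

Lemma Ncomps_disjoint S S' C : S \in AK -> S' \in AK ->
  C \in Ncomps T F0 r K S -> C \in Ncomps T F0 r K S' -> S = S'.
Proof.
move=> hS hS' /(NcompsP _ hS)[hC [e [c [s [ae ecs cC sS]]]]].
case/(NcompsP _ hS')=> _ [e' [c' [s' [ae' ecs' c'C sS']]]].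
apply: (Aclasses_inj hS hS' sS sS').
apply: Dcomponent_outer_equiv hC ae ae' ecs ecs' cC c'C _ _.
  exact: Aclasses_top sS.
exact: Aclasses_top sS'.
Qed.

Lemma Ncomps_cover C : C \in components D ->
  exists2 S, S \in AK & C \in Ncomps T F0 r K S.
Proof.
move=> hC; have [F hF cF] := nu_join feasT; have mF : min_join T F by apply/min_joinP.
have [e [c [s [ecs cC sC sA eF]]]] := Dcomponent_edge hC mF.
have [S hS sS] := Aclasses_cover sA; exists S => //; apply/NcompsP => //.
by split=> //; exists e, c, s; split=> //; apply: allowed_min_join eF.
Qed.

Lemma Ncomps_union : disjoint_union AK (fun S => Ncomps T F0 r K S) (components D).
Proof.
split.
  apply/setP => C; apply/idP/bigcupP => [/Ncomps_cover[S]|[S hS]]; first by exists S.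
  by case/(NcompsP _ hS).
move=> S S' hS hS' SS'; rewrite -setI_eq0; apply/eqP/setP => C; rewrite !in_setI in_set0.
by apply/negP => /andP[hC hC']; case/eqP: SS'; apply: Ncomps_disjoint hC hC'.
Qed.

Lemma Nset_union : disjoint_union AK (fun S => N S) D.
Proof.
split.
  apply/setP => x; apply/idP/bigcupP => [xD|[S hS /bigcupP[C]]].
    have hC := component_of_in xD; have [S hS CS] := Ncomps_cover hC.
    by exists S => //; apply/bigcupP; exists (component_of D x) => //; apply: component_of_mem.
  by case/(NcompsP _ hS) => /component_sub/subsetP hC _ /hC.
move=> S S' hS hS' SS'; rewrite -setI_eq0; apply/eqP/setP => x; rewrite !in_setI in_set0.
apply/negP => /andP[/bigcupP[C hC xC] /bigcupP[C' hC' xC']].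
case/eqP: SS'; apply: (Ncomps_disjoint hS hS' hC).
have [cC _] := NcompsP _ hS hC; have [cC' _] := NcompsP _ hS' hC'.
by rewrite (component_eq cC xC) -(component_eq cC' xC').
Qed.

(** * Negative sets for a given minimum join *)

Section MinJoin.
Variable F : {set E}.
Hypothesis mF : min_join T F.

(** The edge of [F] leaving [C] ends in [S], because all allowed edges leaving [C] lead to one
    class. It has weight -1, and from its inner end, which is on top of [C], [inner_exchange] yields
    a path inside [C] to [x] of weight at most 0. *)
Lemma Nset_negative S : S \in AK -> negative_set F S (N S).
Proof.
move=> hS; split.
  rewrite disjoint_subset; apply/subsetP => x /bigcupP[C /(NcompsP _ hS)[hC _] xC].
  by rewrite inE; apply/negP => /(Aclasses_top hS)/(Dcomponent_notin hC); rewrite xC.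
move=> x /bigcupP[C hCN xC].
have [hC [e' [c' [s' [ae' ecs' c'C s'S]]]]] := NcompsP _ hS hCN.
have [lC rC _] := Dcomponent_level hC.
have [e [c [s [ecs cC sC sA eF]]]] := Dcomponent_edge hC mF.
have ss' : equiv_vertices T s' s.
  apply: (Dcomponent_outer_equiv hC ae' _ ecs' ecs) => //; first exact: allowed_min_join eF.
  exact: Aclasses_top s'S.
have sS : s \in S := Aclasses_closed hS s'S sA ss'.
have [J [sJ hJ cJ]] := inner_exchange bip lC cC rC mF eF ecs cC sC xC.
have [p [gp pJ wp]] := path_of_join mF hJ.
have [fc _ _] := level_boundary bip lC ecs cC sC.
have [_ fx] : feasible (Q ~+ x) /\ f x <= m.-1 by case: lC => fC _ _; apply: fC.
have pC : {subset unzip2 p <= C}.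
  have [wk _ _] := and3P gp.
  apply: (@walk_stay (mem C) (mem (inner_edges C)) c p wk cC) => [e1 /pJ|e1 a b e1ab].
    exact: (subsetP sJ).
  rewrite !inE => /subsetP e1C _ _; apply: e1C.
  by rewrite (joins_ends _ e1ab) eqxx eq_sym (negbTE (joins_neq e1ab)).
exists s, ((e, c) :: p); split=> //.
- rewrite gpath_cons joins_sym ecs gp andbT /=; apply/negP; rewrite inE => /predU1P[sc|/pC].
    by rewrite sc cC in sC.
  by rewrite (negbTE sC).
- rewrite weight_cons eF; move: wp cJ fx; rewrite fc; clear; lia.
- move=> v /=; rewrite inE => /predU1P[->|/pC vC]; apply/bigcupP; by exists C.
Qed.

Lemma Nset_antiroot S : S \in AK -> [disjoint N S & antiroot_class T K].
Proof.
move=> hS; rewrite disjoint_subset; apply/subsetP => x /bigcupP[C /(NcompsP _ hS)[hC _] xC].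
rewrite inE; apply/negP => /(antiroot_class_potential bip feasT lvlK kK rK) fx.
have := subsetP (component_sub hC) _ xC; rewrite inD fx => /andP[_].
by rewrite ltnNge leqnSn.
Qed.

Section Negative.
Variables S X : {set V}.
Hypothesis hS : S \in AK.
Hypothesis negX : negative_set F S X.
(** Made conditional so that one argument covers both [NegAvoid] for the root fragment and [Neg] for
    the other classes. *)
Hypothesis avoid : S = root_fragment T K -> [disjoint X & antiroot_class T K].

(** A negative path from [S] to [x] would join two top vertices of [K], against [top_nu_ge]. *)
Lemma negative_notin_A x : x \in X -> x \notin A.
Proof.
move=> xX; apply/negP => xA.
have [s [p [sS gp wp _]]] := negX.2 _ xX.
have [J hJ cJ] := negative_path_join mF gp wp.
have := Aclasses_top hS sS; move: xA; rewrite !inA => /andP[xK /eqP fx] /andP[sK /eqP fs].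
by have := top_nu_ge bip lvlK sK xK fs fx hJ; rewrite leqNgt cJ.
Qed.

Lemma negative_path x : x \in X -> exists s e v q,
  [/\ [/\ s \in S, joins e s v & v \in X], gpath v q x,
      gpath s ((e, v) :: q) x, (weight F ((e, v) :: q) < 0)%R &
      {subset unzip2 q <= X}].
Proof.
move=> xX; have [s [[|[e v] q] [sS gp wp pX]]] := negX.2 _ xX.
  by move: wp; rewrite /weight big_nil ltxx.
exists s, e, v, q; move: (gp); rewrite {1}gpath_cons => /and3P[esv _ gq].
split=> //; first by split=> //; apply: pX; rewrite inE eqxx.
by move=> w wq; apply: pX; rewrite inE wq orbT.
Qed.

Lemma path_last_in v q x : gpath v q x -> x \in v :: unzip2 q.
Proof. by case/and3P=> _ _ /eqP <-; apply: mem_last. Qed.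

(** A walk can enter [K] only at the inner end of a boundary edge, which is a top vertex and so not
    in [X]. *)
Lemma negative_stay_out v q : walk v q -> v \notin K -> {subset unzip2 q <= X} ->
  {in unzip2 q, forall w, w \notin K}.
Proof.
move=> wk vK qX; apply: (@walk_stay [predC K] predT v q wk) => //.
move=> e a b eab _ aK /qX bX; rewrite !inE in aK *; apply/negP => bK.
have [fb _ _] := level_boundary bip lvlK (etrans (joins_sym _ _ _) eab) bK aK.
by have := negative_notin_A bX; rewrite inA bK fb eqxx.
Qed.

Lemma negative_stay_in C v q : walk v q -> C \in components D -> v \in C ->
  {subset unzip2 q <= X} -> {subset unzip2 q <= C}.
Proof.
move=> wk hC vC qX; apply: (@walk_stay (mem C) predT v q wk) => //.
move=> e a b eab _ aC /qX bX; apply/negPn/negP => bC.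
have [_ _ out] := Dcomponent_level hC.
by have := negative_notin_A bX; rewrite (out _ _ _ eab aC bC).
Qed.

Lemma component_of_D v : v \in X -> v \in K ->
  component_of D v \in components D.
Proof.
move=> vX vK; apply: component_of_in.
by rewrite inE (negative_notin_A vX).
Qed.

(** If the vertex [v] following [s] were in [K], it would be in a component of [G[D(K)]], which the
    path could leave only through [A(K)]. *)
Lemma negative_out_path x : x \in X -> x \notin K -> exists s e v q,
  [/\ [/\ s \in S, joins e s v, v \in X & v \notin K], gpath v q x,
      gpath s ((e, v) :: q) x, (weight F ((e, v) :: q) < 0)%R &
      {in v :: unzip2 q, forall w, w \in X /\ w \notin K}].
Proof.
move=> xX xK; have [s [e [v [q [[sS esv vX] gq gp wp qX]]]]] := negative_path xX.
have [wk _ _] := and3P gq.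
have vK : v \notin K.
  apply/negP => vK; have hC := component_of_D vX vK.
  have qC := negative_stay_in wk hC (component_of_mem _ _) qX.
  have /(subsetP (component_sub hC)) : x \in component_of D v.
    have := path_last_in gq; rewrite in_cons => /predU1P[->|/qC//].
    exact: component_of_mem.
  by rewrite inD (negbTE xK).
exists s, e, v, q; split=> // w; rewrite in_cons => /predU1P[->//|wq].
by split; [apply: qX | apply: negative_stay_out wk vK qX _ wq].
Qed.

(** * A negative set does not leave [K] *)

Section Outside.
Variables (e0 : E) (a b : V).
Hypotheses (e0ab : joins e0 a b) (aK : a \in K) (bK : b \notin K) (e0F : e0 \in F).

Lemma a_top : f a = m.
Proof. by have [] := level_boundary bip lvlK e0ab aK bK. Qed.

Lemma a_root : a \in root_class T K.
Proof.
have [_ /subsetP sub] := root_classP bip feasT lvlK kK rK; apply: sub.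
by apply/inner_endsP; exists e0, b; split=> //; apply: allowed_min_join e0F.
Qed.

(** For the root fragment, [b] belongs to the avoided antiroot class. For another class, [a] is in
    neither [S] nor [X], so a negative path from [S] to [b] misses [e0]; switching along it and [e0]
    gives a join smaller than [top_nu_ge] allows. *)
Lemma b_notin : b \notin X.
Proof.
apply/negP => bX; case/AclassesP: hS => [SE|[cS SR _]].
  have := avoid SE; rewrite disjoint_subset => /subsetP /(_ _ bX).
  have [_ /subsetP sub] := antiroot_classP bip feasT lvlK kK rK.
  rewrite inE sub //; apply/outer_endsP; exists e0, a; split=> //.
  exact: allowed_min_join e0F.
have aS : a \notin S.
  apply/negP => aS; case/eqP: SR.
  exact: (class_inj bip feasT cS root_classC aS a_root).
have [s [p [sS gp wp pX]]] := negX.2 _ bX.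
have aA : a \in A by rewrite inA aK a_top eqxx.
have [hF cF] := min_joinP _ _ mF.
have e0p : e0 \notin path_edges p.
  apply/negP; rewrite inE => e0p; have [wk _ _] := and3P gp.
  have : a \in s :: unzip2 p.
    apply: walk_ends wk e0p _ _.
    by rewrite (joins_ends _ e0ab) eqxx (negbTE (joins_neq e0ab)).
  rewrite in_cons => /predU1P[as_|/pX aX]; first by rewrite as_ sS in aS.
  by have := negative_notin_A aX; rewrite aA.
have hJ : is_join (T ~+ s ~+ a) (F :+: path_edges p ~+ e0).
  by apply: join_eq (join_edge e0ab (join_path hF gp)) _; xor_eq.
have := Aclasses_top hS sS; rewrite inA => /andP[sK /eqP fs].
have := top_nu_ge bip lvlK sK aK fs a_top hJ.
have : e0 \in F :+: path_edges p by rewrite in_symdiff e0F (negbTE e0p).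
move/card_symdiff_in; have := card_path F gp.
by move: wp cF; clear; lia.
Qed.

(** The lower bound is [top_nu_ge], the upper one [inner_exchange] between vertices of equal value:
    [S] is at distance 0 from [a]. *)
Lemma top_nu_root s : s \in S -> feasible (T ~+ a ~+ s) /\ nu (T ~+ a ~+ s) = nu T.
Proof.
move=> /(Aclasses_top hS); rewrite inA => /andP[sK /eqP fs].
have [hF cF] := min_joinP _ _ mF.
have [J [_ hJ cJ]] := inner_exchange bip lvlK kK rK mF e0F e0ab aK bK sK.
have hFJ : is_join (T ~+ a ~+ s) (F :+: J).
  by apply: join_eq (join_symdiff hF hJ) _; xor_eq.
have fas := feasible_join hFJ; split=> //; apply/eqP; rewrite eqn_leq.
have [J' hJ' cJ'] := nu_join fas.
rewrite -{2}cJ' (top_nu_ge bip lvlK aK sK a_top fs hJ') andbT.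
apply: leq_trans (nu_le hFJ) _; rewrite -cF.
by move: cJ; rewrite a_top fs leq_add2r.
Qed.

(** A join inside [K] from [a] to [s], which comes at no cost, is continued by a negative path from
    [s] to [x]. *)
Lemma negative_out_nu x : x \in X -> x \notin K ->
  feasible (T ~+ a ~+ x) /\ nu (T ~+ a ~+ x) < nu T.
Proof.
move=> xX xK; have [s [e [v [q [[sS esv vX vK] gq gp wp qX]]]]] := negative_out_path xX xK.
have := Aclasses_top hS sS; rewrite inA => /andP[sK /eqP fs].
have [hF cF] := min_joinP _ _ mF.
have [J [sJ hJ cJ]] := inner_exchange bip lvlK kK rK mF e0F e0ab aK bK sK.
have hx : is_join (T ~+ a ~+ x) (F :+: J :+: path_edges ((e, v) :: q)).
  by apply: join_eq (join_path (join_symdiff hF hJ) gp) _; xor_eq.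
split; first exact: feasible_join hx.
apply: leq_ltn_trans (nu_le hx) _.
have := card_path (F :+: J) gp; rewrite (@eq_weight _ _ F).
  by move: wp cJ; rewrite a_top fs leq_add2r -cF; clear; lia.
(* Every edge of the path has an end outside [K] whereas [J] lies inside, so [F] and [F :+: J] agree
   on the path. *)
move=> e1 e1p; rewrite in_symdiff.
suff /negbTE -> : e1 \notin J by rewrite addbF.
apply/negP => /(subsetP sJ); rewrite inE => /subsetP e1K.
move: e1p; rewrite /= inE => /predU1P[e1e|e1q].
  have /e1K : v \in ends e1.
    by rewrite e1e (joins_ends _ esv) eqxx eq_sym (negbTE (joins_neq esv)).
  by rewrite (negbTE vK).
have [c [d e1cd]] := joins_exists e1; have [wk _ _] := and3P gq.
have cin : c \in ends e1 by rewrite (joins_ends _ e1cd) eqxx (negbTE (joins_neq e1cd)).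
have [_] := qX _ (walk_ends wk e1q cin).
by rewrite (e1K _ cin).
Qed.

Lemma negative_first_nu s e v : s \in S -> joins e s v -> v \in X -> v \notin K ->
  (nu (T ~+ a ~+ v)).+1 = nu T.
Proof.
move=> sS esv vX vK; have [fs ns] := top_nu_root sS.
have [_ lv] := negative_out_nu vX vK.
by have [_ []] := potential_adj bip esv fs; rewrite /potential ns; move: lv; clear; lia.
Qed.

(* A vertex of X outside K next to S lies, in the distances from a, on top of a
   component of level -1, and so does the first vertex of its negative path;
   that path thus spends a total of -2 between two top vertices. *)
Lemma negative_inside : X \subset K.
Proof.
apply/subsetP => x xX; apply/negPn/negP => xK.
have [s [e [v [q [[sS esv vX vK] _ _ _ _]]]]] := negative_out_path xX xK.
have [s2 [e2 [v2 [q2 [[s2S esv2 v2X v2K] gq2 _ wp2 q2X]]]]] := negative_out_path vX vK.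
have nv := negative_first_nu sS esv vX vK.
have nv2 := negative_first_nu s2S esv2 v2X v2K.
have := Aclasses_top hS s2S; rewrite inA => /andP[s2K _].
(* Only one edge of [F] leaves [K], so otherwise [e2] is [e0] and [v2] is [b]. *)
have e2F : e2 \notin F.
  apply/negP => e2F.
  have e20 := decapital_only bip lvlK kK rK mF e0F e0ab aK bK e2F
    (ends_boundary esv2 s2K v2K).
  rewrite e20 in esv2.
  have [_ v2b] := ends_eq esv2 e0ab s2K v2K aK bK.
  by have := b_notin; rewrite -v2b v2X.
have wq2 : (weight F q2 < 0)%R.
  by move: wp2; rewrite weight_cons (negbTE e2F); clear; lia.
have [J hJ cJ] := negative_path_join mF gq2 wq2.
have hJ' : is_join (T ~+ a ~+ a ~+ v2 ~+ v) J by rewrite symdiffK.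
have [fv2 _] := negative_out_nu v2X v2K.
have := potential_triple bip fv2 _ hJ'; rewrite /potential symdiffK.
suff -> : connect [rel a0 b0 | [&& nu (T ~+ a ~+ a0) <= nu (T ~+ a ~+ v2),
    nu (T ~+ a ~+ b0) <= nu (T ~+ a ~+ v2) & adj a0 b0]] v2 v.
  by move=> /(_ isT); move: nv nv2 cJ; clear; lia.
apply: connect_walk gq2 _ => c d /q2X[cX cK] /q2X[dX dK] cd; rewrite /= cd andbT.
have [_ nc] := negative_out_nu cX cK; have [_ nd] := negative_out_nu dX dK.
by move: nc nd nv2; clear; lia.
Qed.

End Outside.

(** [X] lies in [K] and avoids [A(K)], so a negative path to [x] runs, after its start in [S],
    inside one component [C] of [G[D(K)]]. It remains to find an allowed edge from [C] to [S]. *)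
Lemma negative_sub_Nset : X \subset N S.
Proof.
have [e0 [a [b [e0ab aK bK e0F _]]]] := decapital_edge bip lvlK kK rK mF.
have /subsetP XK := negative_inside e0ab aK bK e0F.
apply/subsetP => x xX.
have [s [e [v [q [[sS esv vX] gq _ _ qX]]]]] := negative_path xX.
have hC := component_of_D vX (XK _ vX).
have vC := component_of_mem D v; set C := component_of D v in hC vC.
have xC : x \in C.
  have [wk _ _] := and3P gq.
  by have := path_last_in gq; rewrite in_cons => /predU1P[->|/(negative_stay_in wk hC vC qX)].
apply/bigcupP; exists C => //; apply/NcompsP => //; split=> //.
(* The negative path is now that of [v], because [v] and [v2] are both next to [S] and hence on top
   of [C]. If its first edge were not in [F], the rest would be a negative path between two top
   vertices of [C]. *)
have [s2 [e2 [v2 [q2 [[s2S esv2 v2X] gq2 _ wp2 q2X]]]]] := negative_path vX.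
have hC2 := component_of_D v2X (XK _ v2X).
have v2C2 := component_of_mem D v2; set C2 := component_of D v2 in hC2 v2C2.
have vC2 : v \in C2.
  have [wk _ _] := and3P gq2.
  by have := path_last_in gq2; rewrite in_cons => /predU1P[->|/(negative_stay_in wk hC2 v2C2 q2X)].
have CC : C2 = C by rewrite (component_eq hC2 vC2).
rewrite CC in v2C2.
exists e2, v2, s2; split=> //; last by rewrite joins_sym.
apply: allowed_min_join mF _; apply/negPn/negP => e2F.
have wq2 : (weight F q2 < 0)%R.
  by move: wp2; rewrite weight_cons (negbTE e2F); clear; lia.
have [J hJ cJ] := negative_path_join mF gq2 wq2.
have [lC rC _] := Dcomponent_level hC.
have [fv2 _ _] := level_boundary bip lC (etrans (joins_sym _ _ _) esv2) v2C2
  (Dcomponent_notin hC (Aclasses_top hS s2S)).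
have [fv _ _] := level_boundary bip lC (etrans (joins_sym _ _ _) esv) vC
  (Dcomponent_notin hC (Aclasses_top hS sS)).
by have := top_nu_ge bip lC v2C2 vC fv2 fv hJ; rewrite leqNgt cJ.
Qed.

End Negative.

Lemma NegAvoid_Nset S : S \in AK -> NegAvoid F S (antiroot_class T K) = N S.
Proof.
move=> hS; have [neg dis sup] := NegAvoidP F S (antiroot_class T K).
apply/eqP; rewrite eqEsubset sup ?andbT; last exact: Nset_antiroot.
  exact: negative_sub_Nset.
exact: Nset_negative.
Qed.

Lemma Neg_Nset S : S \in AK -> S != root_fragment T K -> Neg F S = N S.
Proof.
move=> hS SR; have [neg dis sup] := NegAvoidP F S set0.
apply/eqP; rewrite eqEsubset sup ?andbT.
- by apply: negative_sub_Nset => // SE; rewrite SE eqxx in SR.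
- exact: Nset_negative.
- by rewrite -setI_eq0 setI0.
Qed.

End MinJoin.
End Main.
End Structure.

(** * From integer levels to potentials, and conclusion *)

Lemma eq_disjoint_union (I U : finType) (P : {set I}) (f g : I -> {set U}) (X : {set U}) :
  {in P, f =1 g} -> disjoint_union P f X -> disjoint_union P g X.
Proof.
move=> fg [-> dis]; split; first exact: eq_bigr.
by move=> i j iP jP ij; rewrite -!fg //; apply: dis.
Qed.

(** Shifting by [nu T] turns levels into natural numbers; nonnegativity of the shifted level makes
    the absolute value exact. *)
Lemma level_potential (G : multigraph) (T : {set vertex G}) F r (i : int) :
  min_join T F -> (0 <= i + (nu T)%:Z)%R ->
  level F r i = [set x | feasible (T ~+ r ~+ x) &&
                         (potential (T ~+ r) x <= `|(i + (nu T)%:Z)%R|%N)].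
Proof.
move=> mF i0; apply/setP => x; rewrite !inE; apply/asboolP/andP.
  case=> d /(is_distE _ _ _ mF)[fx ->] di; split=> //.
  by rewrite /potential; move: i0 di; clear; lia.
case=> fx lx; exists ((nu (T ~+ r ~+ x))%:Z - (nu T)%:Z)%R.
  by apply/(is_distE _ _ _ mF).
by move: i0 lx; rewrite /potential; clear; lia.
Qed.

(* F0 is the minimum join with respect to which distances from r are taken. *)
Theorem theorem8p12 (G : multigraph) (T : {set vertex G}) (r : vertex G)
    (F0 : {set edge G}) (K : {set vertex G})
    (hbip : bipartite G) (hgraft : graft T) (hF0 : min_join T F0)
    (hK : decapital F0 r K) :
  let D := Dpart F0 r K in
  let AK := Aclasses T F0 r K in
  let fragK := root_fragment T K in
  let TK := antiroot_class T K in
  (disjoint_union AK (fun S => Ncomps T F0 r K S) (components D) /\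
   disjoint_union AK (fun S => Nset T F0 r K S) D) /\
  (forall F : {set edge G}, min_join T F ->
     [/\ Nset T F0 r K fragK = NegAvoid F fragK TK,
         (forall S : {set vertex G}, S \in AK :\ fragK ->
            Nset T F0 r K S = NegAvoid F S TK /\
            NegAvoid F S TK = Neg F S),
         disjoint_union AK (fun S => NegAvoid F S TK) D
       & disjoint_union AK
           (fun S => if S == fragK then NegAvoid F fragK TK else Neg F S) D]).
Proof.
case: hK => -[i [_ hKi]] rK; have [k kK] := component_ex hKi.
have [hF _] := min_joinP _ _ hF0; have feasT := feasible_join hF.
(* [k] is at distance at most [i], and every distance is at least [- nu T]. *)
have i0 : (0 <= i + (nu T)%:Z)%R.
  have := subsetP (component_sub hKi) _ kK; rewrite inE.
  by case/asboolP=> d /(is_distE _ _ _ hF0)[_ ->]; clear; lia.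
rewrite (level_potential r hF0 i0) in hKi.
have lvlK := component_level hbip hKi; set m := `|_|%N in lvlK.
have fK x : x \in K -> feasible (T ~+ r ~+ x) /\ potential (T ~+ r) x <= m.
  by case: lvlK => fK _ _; apply: fK.
have inA x : (x \in Apart F0 r K) = (x \in K) && (potential (T ~+ r) x == m).
  rewrite inE; case xK: (x \in K) => //=; have [fx lx] := fK _ xK.
  apply/asboolP/eqP.
    case=> d /(is_distE _ _ _ hF0)[_ ->] dmax.
    (* The value [m] is attained in [K], at the inner end of a boundary edge, so a vertex of largest
       distance in [K] has value [m]. *)
    have [e [a [b [eab aK bK _ _]]]] := decapital_edge hbip lvlK kK rK hF0.
    have [fa _ _] := level_boundary hbip lvlK eab aK bK.
    have [fea _] := fK _ aK.
    have := dmax a _ aK (proj2 (is_distE _ _ _ hF0) (conj fea erefl)).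
    by move: lx fa; rewrite /potential; clear; lia.
  move=> fxm; exists ((nu (T ~+ r ~+ x))%:Z - (nu T)%:Z)%R.
    by apply/(is_distE _ _ _ hF0).
  move=> y d' yK /(is_distE _ _ _ hF0)[_ ->]; have [_] := fK _ yK.
  by move: fxm; rewrite /potential; clear; lia.
have NE := NegAvoid_Nset hbip feasT lvlK kK rK inA.
have NN := Neg_Nset hbip feasT lvlK kK rK inA.
have Nu := Nset_union hbip feasT lvlK kK rK inA.
have frag : root_fragment T K \in Aclasses T F0 r K by rewrite in_setU1 eqxx.
move=> D AK fragK TK; split.
  by split=> //; apply: (Ncomps_union hbip feasT lvlK kK rK inA).
move=> F mF; split.
- by rewrite NE.
- by move=> S; rewrite in_setD1 => /andP[SR hS]; rewrite NE // NN.
- by apply: eq_disjoint_union Nu => S hS; rewrite NE.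
- apply: eq_disjoint_union Nu => S hS; case: (S =P fragK) => [->|/eqP SR].
    by rewrite NE.
  by rewrite NN.
Qed.
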